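(* Let $U\subset S=K[x_1,\dots,x_n]$ be the universal lex ideal $$U=(x_1^{a_1+1},\,x_1^{a_1}x_2^{a_2+1},\,\dots,\,x_1^{a_1}\cdots x_{t-1}^{a_{t-1}}x_t^{a_t+1}).$$ Let $M\subset U$ be a (finite) ladder set and $L\subset U$ the extremal set with $\#L=\#M$. Then $m(L)\succeq m(M)$.
   Context: $K$ is a field, $S=K[x_1,\dots,x_n]$ is standard graded, $>_{\mathrm{lex}}$ is the lexicographic order with $x_1>\cdots>x_n$. Spaces spanned by monomials are identified with their sets of monomials. Here $1\le t\le n$ and $a_1,\dots,a_t\ge 0$ are integers, or $U=S$ with $t=1$, $a_1=-1$. Put $\delta_i=x_1^{a_1}\cdots x_{i-1}^{a_{i-1}}x_i^{a_i+1}$, $b_i=\deg\delta_i=a_1+\cdots+a_i+1$, $S^{(i)}=K[x_i,\dots,x_n]$, $U^{(i)}=\delta_iS^{(i)}$, $U^{(\ge i)}=\biguplus_{k=i}^tU^{(k)}$; thus $U=U^{(\ge1)}$. For $M\subset U$ put $M^{(i)}=M\cap U^{(i)}$, $M^{(\ge i)}=M\cap U^{(\ge i)}$; $M_k$ is the set of monomials of degree $k$ in $M$. Ladder set: a set of monomials $M\subset U$ such that (i) for each $i$, $N_i=\{u\in S^{(i)}:\delta_iu\in M\}$ is rev-lex ($u\in N_i$, $v<_{\mathrm{lex}}u$ a monomial of $S^{(i)}$ of the same degree imply $v\in N_i$) and a multicomplex ($u\in N_i$, $v\mid u$ imply $v\in N_i$); (ii) for $i=1,\dots,t-1$ and all $j$,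 $M^{(i)}_j\ne\emptyset$ implies $M^{(i+1)}_j=U^{(i+1)}_j$. Moving map: for $i\le t-1$ and $u$ a monomial in $K[x_{i+1},\dots,x_n]$, $\rho(\delta_ix_i^ku)=\delta_{i+1}u$. Orders: $u>_{\mathrm{opdlex}}v$ if $\deg u<\deg v$, or $\deg u=\deg v$ and $u>_{\mathrm{lex}}v$; $u>_{\mathrm{dlex}}v$ if $\deg u>\deg v$, or $\deg u=\deg v$ and $u>_{\mathrm{lex}}v$. Admissibility: a monomial $f\in U^{(i)}_e$ is admissible (over $U^{(\ge i)}$) if (a) for $j=1,\dots,t-i-1$, $\deg\rho^j(f)\le e+1$ or $\rho^j(f)=\delta_{i+j}$; and (b) $\rho^{t-i}(f)=\delta_t$ or $\rho^{t-i}(f)\ge_{\mathrm{opdlex}}\delta_tx_t^{e+1-b_t}$ (the second alternative being impossible if $e+1-b_t<0$). If $i=t$ every monomial of $U^{(t)}$ is admissible. Extremal set: a finite set of monomials $M\subset U$ is extremal if for every $k=1,\dots,t$ one has $M^{(k)}=\{h\in U^{(k)}:h\le_{\mathrm{dlex}}f_k\}$, where $f_k$ is the $>_{\mathrm{dlex}}$-largest admissible $g\in U^{(k)}$ with $\#\{h\in U^{(\ge k)}:h\le_{\mathrm{dlex}}g\}\le\#M^{(\ge k)}$ (and $M^{(k)}=\emptyset$ if no such $g$ exists). There is exactly one extremal set of each finite cardinality. For a monomial $u$, $\max u$ is the largest $\ell$ with $x_\ell\mid u$, $\max(1)=1$; $m_{\le i}(M)=\#\{u\in M:\max u\le i\}$,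 $m(M)=(m_{\le1}(M),\dots,m_{\le n}(M))$; $\mathbf a\succeq\mathbf b$ means $a_i\ge b_i$ for all $i$. *)

(* Defs.v *)
From HB Require Import structures.
From mathcomp Require Import all_boot all_order all_algebra.
From mathcomp Require Export finmap.
From mathcomp Require Export mpoly.

Set Implicit Arguments.
Unset Strict Implicit.
Unset Printing Implicit Defensive.

Import Order.TTheory GRing.Theory Num.Theory.

(* All indices are shifted to start at 0: the variables are x_0, ..., x_(n-1), *)
(* and the pieces of U are numbered 0, ..., t-1.                              *)

Section MonomialOrders.
Variable n : nat.
Implicit Types u v : 'X_{1..n}.

(* The library's order (_ < _)%O on 'X_{1..n} is documented as degrevlex but  *)
(* defined as degree-lexicographic, so the orders are written out here.       *)
Definition lex_lt v u : bool :=
  [exists i : 'I_n, (v i < u i) && [forall j : 'I_n, (j < i) ==> (v j == u j)]].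

Definition opdlex_gt u v : bool :=
  (mdeg u < mdeg v) || (mdeg u == mdeg v) && lex_lt v u.

Definition opdlex_ge u v : bool := (u == v) || opdlex_gt u v.

Definition dlex_gt u v : bool :=
  (mdeg v < mdeg u) || (mdeg u == mdeg v) && lex_lt v u.

Definition dlex_le v u : bool := (v == u) || dlex_gt u v.

End MonomialOrders.

Section UniversalLex.
Variables (n t : nat) (a : t.-tuple int).
Implicit Types (i j k : nat) (f g h u v : 'X_{1..n}).

(* Covers both cases of the standing assumption: all a_i nonnegative, or      *)
(* t = 1 and a_0 = -1, where U = S.                                           *)
Definition universal_lex_data : Prop :=
  0 < t <= n /\
  ((forall i : 'I_t, (0 <= tnth a i)%R) \/ (a = [:: (-1)%R] :> seq int)).

(* The absolute values only convert to nat: under universal_lex_data the      *)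
(* integers a_j (for j < i < t) and a_i + 1 are nonnegative.                  *)
Definition delta i : 'X_{1..n} :=
  [multinom (if j < i then `|(a`_j)%R|%N
             else if j == i :> nat then `|(a`_i + 1)%R|%N else 0)%N | j < n].

Definition bdeg i : nat := mdeg (delta i).

Definition varpow i k : 'X_{1..n} :=
  [multinom (if j == i :> nat then k else 0)%N | j < n].

Definition Smon i u : bool := [forall j : 'I_n, (j < i) ==> (u j == 0)].

Definition Upiece i h : bool :=
  (delta i <= h)%MM && Smon i (h - delta i)%MM.

Definition Uge i h : bool := [exists k : 'I_t, (i <= k) && Upiece k h].

Section Ideal.
Variable K : fieldType.

Definition universal_lex_ideal (p : {mpoly K[n]}) : Prop :=
  exists c : 'I_t -> {mpoly K[n]}, p = (\sum_(i < t) c i * 'X_[delta i])%R.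

Definition Umon h : Prop := universal_lex_ideal 'X_[h].

End Ideal.

Definition piece (M : {fset 'X_{1..n}}) i : {fset 'X_{1..n}} :=
  [fset h in M | Upiece i h]%fset.

Definition piece_ge (M : {fset 'X_{1..n}}) i : {fset 'X_{1..n}} :=
  [fset h in M | Uge i h]%fset.

Definition Npiece (M : {fset 'X_{1..n}}) i : pred 'X_{1..n} :=
  [pred u | Smon i u && ((delta i + u)%MM \in M)].

Definition rev_lex i (N : pred 'X_{1..n}) : Prop :=
  forall u v, u \in N -> Smon i v -> mdeg v = mdeg u -> lex_lt v u -> v \in N.

Definition multicomplex (N : pred 'X_{1..n}) : Prop :=
  forall u v, u \in N -> (v <= u)%MM -> v \in N.

Definition ladder_set (K : fieldType) (M : {fset 'X_{1..n}}) : Prop :=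
  [/\ forall h, h \in M -> Umon K h,
      forall i, i < t -> rev_lex i (Npiece M i) /\ multicomplex (Npiece M i)
    & forall i d, i.+1 < t ->
        (exists2 h, h \in piece M i & mdeg h = d) ->
        forall h, mdeg h = d -> (h \in piece M i.+1) = Upiece i.+1 h].

Definition moving i f : 'X_{1..n} :=
  (delta i.+1 +
   [multinom (if i < j then (f - delta i)%MM j else 0)%N | j < n])%MM.

(* rho^j(f) for f in U^(i): the successive applications of the moving map     *)
(* take place on U^(i), U^(i+1), ..., U^(i+j-1).                              *)
Fixpoint moving_iter i j f : 'X_{1..n} :=
  if j is j'.+1 then moving (i + j') (moving_iter i j' f) else f.

Definition admissible i f : bool :=
  Upiece i f &&
  ((i.+1 == t) ||
   let e := mdeg f in
   let r := moving_iter i (t.-1 - i) f in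
   (* condition (a), for 1 <= j and i + j < t - 1 *)
   [forall j : 'I_t, (0 < j) && (i + j < t.-1) ==>
      ((mdeg (moving_iter i j f) <= e.+1)
       || (moving_iter i j f == delta (i + j)))]
   &&
   (* condition (b); bdeg t.-1 <= e.+1 makes the subtraction exact *)
   ((r == delta t.-1)
    || (bdeg t.-1 <= e.+1)
       && opdlex_ge r (delta t.-1 + varpow t.-1 (e.+1 - bdeg t.-1))%MM)).

(* h <=_dlex g forces deg h <= deg g, so bounding the degree loses nothing. *)
Definition count_dlex_le k g : nat :=
  #|[pred h : 'X_{1..n < (mdeg g).+1} | Uge k h && dlex_le h g]|.

Definition extremal_candidate (M : {fset 'X_{1..n}}) k g : Prop :=
  [/\ Upiece k g, admissible k g & count_dlex_le k g <= #|` piece_ge M k|].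

Definition extremal_set (K : fieldType) (M : {fset 'X_{1..n}}) : Prop :=
  (forall h, h \in M -> Umon K h) /\
  forall k, k < t ->
    (exists f, [/\ extremal_candidate M k f,
                   forall g, extremal_candidate M k g -> dlex_le g f
                 & forall h, (h \in piece M k) = Upiece k h && dlex_le h f])
    \/ ((forall g, ~ extremal_candidate M k g) /\ piece M k = fset0).

End UniversalLex.

(* With 0-based indices the default value 0 gives max(1) = 0, i.e. x_0.       *)
Definition maxvar n (u : 'X_{1..n}) : nat := \max_(l < n | 0 < u l) l.

Definition mvec n (M : {fset 'X_{1..n}}) (i : 'I_n) : nat :=
  #|` [fset u in M | maxvar u <= i]%fset|.

Definition succeq n (x y : 'I_n -> nat) : Prop := forall i, y i <= x i.

(* U is the union of its pieces U^(0), ..., U^(t-1). *)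
Lemma UmonP n t (a : t.-tuple int) (K : fieldType) (h : 'X_{1..n}) :
  universal_lex_data n a -> Umon a K h <-> Uge a 0 h.
Proof.
case=> /andP[t_gt0 le_tn] ha; split; last first.
  case/existsP=> k /andP[_ /andP[le_dh _]].
  exists (fun i => if i == k then 'X_[(h - delta n a k)%MM] else 0)%R.
  rewrite (bigD1 k) //= eqxx big1 ?addr0 => [|i /negPf->]; last by rewrite mul0r.
  by rewrite -mpolyXD submK.
case=> c hE.
have /existsP[i0 Hi0] : [exists i : 'I_t, (delta n a i <= h)%MM].
  case: (boolP [exists i, _]) => // /existsPn no_i.
  have /eqP := congr1 (mcoeff h) hE; rewrite mcoeffX eqxx raddf_sum /= big1.
    by rewrite oner_eq0.
  move=> i _; apply/eqP; rewrite mcoeff_eq0; apply/negP=> /msuppM_le.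
  case/allpairsP=> -[m1 m2] /= [_]; rewrite msuppX inE => /eqP-> hE'.
  by have := no_i i; rewrite hE' lem_addl.
have [i le_ih min_i] : exists2 i : 'I_t, (delta n a i <= h)%MM &
    forall j : 'I_t, j < i -> ~~ (delta n a j <= h)%MM.
  case: (@arg_minnP _ i0 (fun i : 'I_t => delta n a i <= h)%MM (fun i => val i) Hi0).
  move=> i Hi mini.
  exists i => // j lt_ji; apply/negP=> /mini /=; by rewrite leqNgt lt_ji.
apply/existsP; exists i; rewrite /= /Upiece le_ih.
apply/forallP=> j; apply/implyP=> lt_ji.
rewrite mnmBE subn_eq0 leqNgt mnmE lt_ji; apply/negP=> lt_ah.
have lt_jt := ltn_trans lt_ji (ltn_ord i).
case: ha => [ha|aE]; last first.
  have t1 : t = 1%N by rewrite -(size_tuple a) aE.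
  by move: (ltn_ord i) lt_ji; rewrite {2}t1; case: (nat_of_ord i).
have := min_i (Ordinal lt_jt) lt_ji; case/negP; apply/mnm_lepP=> l.
have a_ge0 : (0 <= a`_j)%R.
  by have := ha (Ordinal lt_jt); rewrite (tnth_nth 0%R).
rewrite mnmE /=; case: ltnP => [lt_lj|le_jl].
  have /mnm_lepP/(_ l) := le_ih.
  by rewrite mnmE (ltn_trans lt_lj lt_ji).
case: eqP => [/val_inj-> | //].
have : (`|(a`_j + 1)%R|%N = `|(a`_j)%R|.+1)%N.
  by case: (nth _ _ _) a_ge0 => // m _; rewrite -PoszD absz_nat addn1.
by move->.
Qed.

(* Main.v *)
Require Import Defs.
From HB Require Import structures.
From mathcomp Require Import all_boot all_order all_algebra.
From mathcomp Require Import finmap mpoly.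
From mathcomp Require Import zify.

(** Fix [l].  A ladder set meets each degree of each piece [U^(j)] in its
    lex-smallest monomials, so it is described by sizes, and the number of its
    monomials [h] with [max h <= l] is read off from the function [s j], where
    [s j z] counts such monomials among the [z] lex-largest ones of a given
    degree in [x_j, x_(j+1), ...].  This does not depend on the degree, because
    multiplication by [x_j] preserves both the order and the predicate.  The
    function [s j] is subadditive (a top lex segment beats every interval) and
    [s N + s (y - x) <= s y + s (N - x)] when [x <= y <= N] and [N] is the
    number of monomials of some degree (a bottom segment of that degree is beaten
    by every interval in a degree that is not larger).  Both properties pass from
    [x_(j+1), ...] to [x_j, ...].

    Let [E j p] be the largest number of such [h] in a ladder set of size [p] in
    [U^(>=j)].
    Descending induction on [j] proves two exchange inequalities.  Removing
    [z <= N] monomials costs at most [s j z], if [p] is at least [z] plus the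
    number of monomials of [x_j, ...] of degree smaller than that of [N].
    Adding [N - z] monomials to a ladder set of [U^(>j)] of size [p < z] gains at
    least [s j N - s j z], the value of the [N - z] bottom monomials of a degree
    of [U^(j)].
    The first admissible position in degree [e] of [U^(j)] leaves exactly
    [#U^(>j)_(<=e)] monomials above it, so whether monomials should move from a
    partially filled degree of [U^(j)] into [U^(>j)] or back is decided by
    comparing the size [p] of the part in [U^(>j)] with the number [z] of
    missing monomials. *)

Set Implicit Arguments.
Unset Strict Implicit.
Unset Printing Implicit Defensive.

Import Order.TTheory.

(** * Exchange inequalities *)

Section Core.

Variables (t : nat) (N s : nat -> nat -> nat) (b : nat -> nat).

(* [N j d] is the number of monomials of degree [d] in [x_j, x_(j+1), ...],
   [s j z] the number of counted ones among the [z] lex-largest, and [b j] the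
   degree of [delta j]. *)
Hypothesis b_mono : forall j, j.+1 < t -> b j <= b j.+1.
Hypothesis N0 : forall j, j < t -> N j 0 = 1.
Hypothesis N_mono : forall j d, j < t -> N j d <= N j d.+1.
Hypothesis NS : forall j d, j.+1 < t -> N j d.+1 = N j d + N j.+1 d.+1.
Hypothesis s0 : forall j, s j 0 = 0.
Hypothesis s_mono : forall j x y, x <= y -> s j x <= s j y.
Hypothesis s_sub : forall j x y, s j (x + y) <= s j x + s j y.
Hypothesis s_top : forall j d x y, j < t -> x <= y -> y <= N j d ->
  s j (N j d) + s j (y - x) <= s j y + s j (N j d - x).
Hypothesis sS : forall j d x, j.+1 < t -> x <= N j.+1 d.+1 ->
  s j (N j d + x) = s j (N j d) + s j.+1 x.
Hypothesis s1 : forall j, j.+1 < t -> s j.+1 1 <= s j 1.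

Definition below j d := \sum_(i < d) N j i.
(* Numbers of monomials of [U^(j)] of degree [< e] and of degree [e]. *)
Definition piece_below j e := below j (e - b j).
Definition piece_at j e := if b j <= e then N j (e - b j) else 0.
Definition value_below j e := \sum_(i < e - b j) s j (N j i).

Fixpoint ge_below r j e :=
  if r is r'.+1 then piece_below j e + ge_below r' j.+1 e else 0.

Fixpoint ge_at r j e :=
  if r is r'.+1 then piece_at j e + ge_at r' j.+1 e else 0.

(* A ladder set of size [p] with [v] counted monomials in the [r] pieces
   [U^(j), U^(j+1), ...], each of which it meets in a lower dlex segment: the
   monomials of [U^(j)] of degree [< e] and the [k] lex-smallest of degree [e].
   The summand [s j (piece_at j e - k)] on the left replaces a subtraction. *)
Fixpoint config r j p v : Prop :=
  if r is r'.+1 then exists e k p' v',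
    [/\ k <= piece_at j e, p = piece_below j e + k + p',
        v + s j (piece_at j e - k) = value_below j e + s j (piece_at j e) + v',
        config r' j.+1 p' v' &
        ge_below r' j.+1 e <= p' /\ (0 < k -> ge_below r' j.+1 e.+1 <= p')]
  else p = 0 /\ v = 0.

Lemma belowS j d : below j d.+1 = below j d + N j d.
Proof. by rewrite /below big_ord_recr. Qed.

Lemma below0 j : below j 0 = 0.
Proof. by rewrite /below big_ord0. Qed.

Lemma N_le j d d' : j < t -> d <= d' -> N j d <= N j d'.
Proof.
move=> lt_jt /subnK <-; elim: (d' - d) => //= k IHk.
by rewrite addSn (leq_trans IHk) // N_mono.
Qed.

Lemma N_gt0 j d : j < t -> 0 < N j d.
Proof. by move=> lt_jt; rewrite -(N0 lt_jt) N_le. Qed.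

(** Setting [x_j] to 1 identifies the monomials of degree [d] in [x_j, ...] with those of degree at
    most [d] in [x_(j+1), ...]. *)
Lemma below_child j d : j.+1 < t -> below j.+1 d.+1 = N j d.
Proof.
move=> lt_jt; elim: d => [|d IHd].
  by rewrite belowS below0 !N0 // ltnW.
by rewrite belowS IHd -NS.
Qed.

Lemma below_le j d d' : d <= d' -> below j d <= below j d'.
Proof.
move=> /subnK <-; elim: (d' - d) => //= k IHk.
by rewrite addSn belowS; lia.
Qed.

Lemma leq_below j d : j < t -> d <= below j d.
Proof. by move=> h; elim: d => // d IHd; rewrite belowS; have := N_gt0 d h; lia. Qed.

Lemma piece_belowS j e : piece_below j e.+1 = piece_below j e + piece_at j e.
Proof.
rewrite /piece_below /piece_at; case: leqP => h; first by rewrite subSn // belowS.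
have -> : e.+1 - b j = e - b j by lia.
by rewrite addn0.
Qed.

Lemma value_belowS j e :
  value_below j e.+1 = value_below j e + s j (piece_at j e).
Proof.
rewrite /value_below /piece_at; case: leqP => h.
  by rewrite subSn // big_ord_recr.
have -> : e.+1 - b j = e - b j by lia.
by rewrite s0 addn0.
Qed.

Lemma ge_belowS r j e : ge_below r j e.+1 = ge_below r j e + ge_at r j e.
Proof. by elim: r j => //= r IHr j; rewrite IHr piece_belowS; lia. Qed.

Lemma ge_below_le r j e e' : e <= e' -> ge_below r j e <= ge_below r j e'.
Proof.
move=> /subnK <-; elim: (e' - e) => //= k IHk.
by rewrite addSn ge_belowS; lia.
Qed.

Lemma ge_at_small r j e : r + j = t -> (0 < r -> e < b j) -> ge_at r j e = 0.
Proof.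
elim: r j => //= r IHr j rj lt_eb; rewrite IHr; last 2 first.
- lia.
- by move=> r0; have := @b_mono j; lia.
by rewrite /piece_at leqNgt lt_eb.
Qed.

Lemma ge_below_small r j e : r + j = t -> (0 < r -> e <= b j) -> ge_below r j e = 0.
Proof.
elim: e => [|e IHe] rj h.
  elim: r j rj {h} => //= r IHr j rj.
  by rewrite IHr /piece_below ?sub0n ?below0 //; lia.
by rewrite ge_belowS IHe ?ge_at_small; lia.
Qed.

(** [NS] splits the right-hand side into the contribution of [U^(j)] and [N j.+1 (e - b j).+1],
    which by induction and [b_mono] bounds the later pieces. *)
Lemma ge_at_bound r j e : r.+1 + j = t -> b j <= e ->
  ge_at r.+1 j e <= N j (e - b j).+1.
Proof.
elim: r j e => [|r IHr] j e rj le_be.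
  by rewrite /= addn0 /piece_at le_be N_mono; lia.
rewrite -[ge_at _ _ _]/(piece_at j e + ge_at r.+1 j.+1 e).
rewrite {1}/piece_at le_be NS; last by lia.
rewrite leq_add2l; case: (leqP (b j.+1) e) => [le_b'e|lt_eb'].
  apply: leq_trans (IHr _ _ _ le_b'e) _; first lia.
  by apply: N_le; [lia|have := @b_mono j; lia].
by rewrite ge_at_small; lia.
Qed.

(** By [ge_at_bound], raising [c] by one adds to the left at most the [N j.+1 c.+1] that [NS] adds
    to the right. So one degree of [U^(j)] outnumbers all monomials of [U^(>j)] of smaller
    degree. *)
Lemma ge_below_bound r j c : r + j.+1 = t -> ge_below r j.+1 (b j + c) < N j c.
Proof.
case: r => [|r] rj; first by apply: N_gt0; lia.
have b_le : b j <= b j.+1 by apply: b_mono; lia.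
elim: c => [|c IHc].
  by rewrite N0 ?ge_below_small; lia.
rewrite addnS ge_belowS NS; last lia.
case: (leqP (b j.+1) (b j + c)) => h; last by rewrite ge_at_small; lia.
have := @ge_at_bound r j.+1 (b j + c) ltac:(lia) h.
have := @N_le j.+1 (b j + c - b j.+1).+1 c.+1 ltac:(lia) ltac:(lia).
lia.
Qed.

Lemma split_block_pos j z : j.+1 < t -> 1 < z ->
  exists d z', [/\ z = N j d + z', 0 < z' & z' <= N j.+1 d.+1].
Proof.
move=> lt_jt; elim: z => // z IHz lt1z.
case: (ltnP 1 z) => [/IHz [d [z' [-> z'_gt0 z'_le]]]|le_z1].
  case: (ltnP z' (N j.+1 d.+1)) => h; first by exists d, z'.+1; split; lia.
  exists d.+1, 1; rewrite NS //; split=> //; first lia.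
  by apply: N_gt0.
exists 0, 1; rewrite N0; last lia.
by split=> //; [lia | apply: N_gt0].
Qed.

Lemma split_block_lt j z : j.+1 < t -> 0 < z ->
  exists d z', [/\ z = N j d + z' & z' < N j.+1 d.+1].
Proof.
move=> lt_jt; elim: z => // z IHz _.
case: (posnP z) => [->|/IHz [d [z' [-> h]]]].
  exists 0, 0; rewrite N0; last lia.
  by split=> //; apply: N_gt0.
case: (ltnP z'.+1 (N j.+1 d.+1)) => h'; first by exists d, z'.+1; split; lia.
exists d.+1, 0; rewrite NS //; split; first lia.
by apply: N_gt0.
Qed.

(** * Removing monomials from a ladder set *)

Definition removable r j := forall p v d z, config r j p v -> z <= N j d ->
  z + below j d <= p -> exists2 v', config r j (p - z) v' & v <= v' + s j z.

(* Removal from [U^(>j)], charged at the rate of a block of [U^(j)]. *)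
Definition removable_parent r j := forall p v z, config r j.+1 p v ->
  z <= p -> exists2 v', config r j.+1 (p - z) v' & v <= v' + s j z.

(** Write [z = N j d + z'] and remove the [z'] first, at the rate of degree [d.+1] in
    [x_(j+1), ...]. The size condition of [removable] holds because [below j.+1 d.+1] is [N j d],
    and [sS] adds up the costs. *)
Lemma removable_parent_of r j : r + j.+1 = t -> (0 < r -> removable r j.+1) ->
  removable_parent r j.
Proof.
case: r => [|r] rj rem p v z.
  by move=> [-> ->]; rewrite leqn0 => /eqP->; exists 0.
have {}rem := rem isT; have lt_jt : j.+1 < t by lia.
elim/ltn_ind: z p v => z IHz p v cfg le_zp.
case: (ltnP 1 z) => [|le_z1].
  case/(split_block_pos lt_jt) => d [z' [zE z'_gt0 z'_le]].
  have [|v1 cfg1 le_v1] := rem _ _ _ _ cfg z'_le.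
    by rewrite below_child //; lia.
  have [||v2 cfg2 le_v2] := IHz (N j d) _ _ _ cfg1; try lia.
  exists v2; first by have <- : p - z' - N j d = p - z by lia.
  by rewrite zE sS //; lia.
case: (posnP z) => [->|z_gt0]; first by exists v; rewrite ?subn0 ?s0 ?addn0.
have z1 : z = 1 by lia.
have [||v1 cfg1 le_v1] := rem _ _ 0 1 cfg.
- by rewrite N0.
- by rewrite below0; lia.
exists v1; rewrite z1 //; have := s1 lt_jt; lia.
Qed.

(* [e] is the first degree in which [U^(>=j)] need not be filled completely. *)
Lemma normal_form r j p v : r + j.+1 = t -> removable_parent r j ->
  config r.+1 j p v ->
  exists e k p' v', [/\ k <= piece_at j e, p = piece_below j e + k + p',
        v + s j (piece_at j e - k) <= value_below j e + s j (piece_at j e) + v',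
        config r j.+1 p' v' &
        [/\ ge_below r j.+1 e <= p', 0 < k -> ge_below r j.+1 e.+1 <= p',
         p < ge_below r.+1 j e.+1, ge_below r.+1 j e <= p & b j <= e]].
Proof.
move=> rj rem [e [k [p' [v' [le_k pE vE cfg' [le_p' kP]]]]]].
(* Fuel for filling one degree after another: [leq_below] bounds [e - b j] by [piece_below j e],
   hence by [p]. *)
have [n len] : exists n, p + (b j).+1 <= e + n by exists (p + (b j).+1); lia.
have {}vE : v + s j (piece_at j e - k) <=
  value_below j e + s j (piece_at j e) + v' by lia.
elim: n e k p' v' len le_k pE vE cfg' le_p' kP
    => [|n IHn] e k p' v' len le_k pE vE cfg' le_p' kP.
  have := @leq_below j (e - b j) ltac:(lia).
  rewrite -/(piece_below j e); lia.
case: (ltnP p (ge_below r.+1 j e.+1)) => [lt_p|le_p].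
  exists e, k, p', v'; split=> //; split=> //.
    by rewrite /=; lia.
  case: (leqP (b j) e) => // lt_eb; move: lt_p.
  by rewrite ge_below_small; lia.
have le_p1 : piece_below j e.+1 + ge_below r j.+1 e.+1 <= p by [].
rewrite piece_belowS in le_p1.
(* There is room for all of [U^(>=j)] up to degree [e], so [U^(j)_e] is completed with monomials
   taken from [U^(>j)]; they cost at most [s j (piece_at j e - k)], which is what the completion
   gains. *)
have [|v1 cfg1 le_v1] := rem _ _ (piece_at j e - k) cfg'; first lia.
apply: (IHn e.+1 0 (p' - (piece_at j e - k)) v1) => //; try lia.
- by rewrite piece_belowS; lia.
- by rewrite subn0 value_belowS; lia.
Qed.

Lemma config_stage r j e k p' v' : k <= piece_at j e ->
  config r j.+1 p' v' -> ge_below r j.+1 e <= p' ->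
  (0 < k -> ge_below r j.+1 e.+1 <= p') ->
  exists2 v, config r.+1 j (piece_below j e + k + p') v &
    v + s j (piece_at j e - k) = value_below j e + s j (piece_at j e) + v'.
Proof.
move=> le_k cfg le_p' kP.
have le_s := @s_mono j (piece_at j e - k) (piece_at j e) (leq_subr _ _).
exists (value_below j e + (s j (piece_at j e) - s j (piece_at j e - k)) + v').
  by exists e, k, p', v'; split=> //; lia.
lia.
Qed.

(* The [z] missing monomials of [U^(>=j)_e] are a top lex segment even if they
   lie in several pieces, which is why [s j] alone measures the gain. *)
Lemma add_degree r j p v e : r + j = t ->
  (forall r' j', r' + j'.+1 = t -> j <= j' -> removable_parent r' j') ->
  config r j p v -> ge_below r j e <= p -> p < ge_below r j e.+1 ->
  exists z, [/\ 0 < z, z <= ge_at r j e, ge_below r j e.+1 <= p + z &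
    forall u, u <= z -> exists2 v', config r j (p + u) v' &
      v + s j z <= v' + s j (z - u)].
Proof.
elim: r j p v => [|r IHr] j p v rj rem cfg le_p lt_p //.
have rj' : r + j.+1 = t by lia.
have [e1 [k [p' [v' [le_k pE vE cfg' [le_p' kP lt_p1 le_p1 le_be]]]]]] :=
  normal_form rj' (rem _ _ rj' (leqnn j)) cfg.
have e1E : e1 = e.
  case: (ltngtP e1 e) => // h.
    have := @ge_below_le r.+1 j _ _ h; lia.
  have := @ge_below_le r.+1 j _ _ h; lia.
subst e1.
have lt_p2 : p < piece_below j e.+1 + ge_below r j.+1 e.+1 by [].
rewrite piece_belowS in lt_p2.
have capE : piece_at j e = N j (e - b j) by rewrite /piece_at le_be.
case: (leqP (ge_below r j.+1 e.+1) p') => [le_p'1|lt_p'1].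
  exists (piece_at j e - k); split=> //=; try lia.
  - by rewrite piece_belowS; lia.
  move=> u le_u.
  have [||v2 cfg2 v2E] := @config_stage r j e (k + u) _ _ _ cfg' le_p'; try lia.
  exists v2; first by have <- : piece_below j e + (k + u) + p' = p + u by lia.
  have -> : piece_at j e - k - u = piece_at j e - (k + u) by lia.
  lia.
have k0 : k = 0 by lia.
subst k; rewrite subn0 in vE.
have [] // := IHr j.+1 p' v' rj' _ cfg' le_p' lt_p'1.
  by move=> r' j' *; apply: rem; lia.
move=> z [z_gt0 le_z le_pz zP].
have rpos : 0 < r by case: (r) z_gt0 le_z => //=; lia.
have lt_jt : j.+1 < t by lia.
have le_zN : z <= N j.+1 (e - b j).+1.
  case: (r) rpos rj' le_z => // r1 _ rj' le_z.
  apply: leq_trans le_z _; case: (leqP (b j.+1) e) => h.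
    apply: leq_trans (ge_at_bound rj' h) _; apply: N_le; first lia.
    by have := b_mono lt_jt; lia.
  by rewrite ge_at_small //; lia.
exists (piece_at j e + z); split=> //=; try lia.
- by rewrite piece_belowS; lia.
move=> u le_u; rewrite capE sS //.
(* Monomials are added from the lex-smallest upwards: those of [U^(>j)] first, and those of [U^(j)]
   only when these are used up. *)
case: (leqP u z) => [le_uz|lt_zu].
  have [v1 cfg1 le_v1] := zP u le_uz.
  have [||v2 cfg2 v2E] := @config_stage r j e 0 _ _ (leq0n _) cfg1; try lia.
  exists v2; first by have <- : piece_below j e + 0 + (p' + u) = p + u by lia.
  rewrite subn0 in v2E.
  by rewrite -addnBA // sS; lia.
have [v1 cfg1 le_v1] := zP z (leqnn _); rewrite subnn s0 in le_v1.
have [|||v2 cfg2 v2E] := @config_stage r j e (u - z) _ _ _ cfg1; try lia.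
exists v2; first by have <- : piece_below j e + (u - z) + (p' + z) = p + u by lia.
have -> : N j (e - b j) + z - u = piece_at j e - (u - z) by lia.
by rewrite capE in v2E *; lia.
Qed.

(* The monomials are removed from the last two degrees of [U^(j)]; if these are
   too small, all of [U^(j)_(e-1)] goes, together with a part of [U^(>j)]. *)
Lemma removable_low r j e k p p' v v' d z : r + j.+1 = t ->
  removable_parent r j -> (0 < r -> removable r j.+1) ->
  k <= piece_at j e -> p = piece_below j e + k + p' ->
  v + s j (piece_at j e - k) <= value_below j e + s j (piece_at j e) + v' ->
  config r j.+1 p' v' -> ge_below r j.+1 e <= p' ->
  (0 < k -> ge_below r j.+1 e.+1 <= p') -> b j <= e ->
  0 < z -> z <= N j d -> z + below j d <= p -> d <= e - b j ->
  exists2 v2, config r.+1 j (p - z) v2 & v <= v2 + s j z.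
Proof.
move=> rj rem remc le_k pE vE cfg le_p' kP le_be z_gt0 le_zN le_zp le_d.
have lt_jt : j < t by lia.
have capE : piece_at j e = N j (e - b j) by rewrite /piece_at le_be.
have le_zcap : z <= piece_at j e by rewrite capE (leq_trans le_zN) // N_le.
case: (leqP z k) => [le_zk|lt_kz].
  have [||v2 cfg2 v2E] := @config_stage r j e (k - z) _ _ _ cfg le_p'; try lia.
  exists v2; first by have <- : piece_below j e + (k - z) + p' = p - z by lia.
  have := s_sub j (piece_at j e - k) z.
  have -> : piece_at j e - k + z = piece_at j e - (k - z) by lia.
  lia.
(* All [k] monomials of degree [e] go first; by [s_top] their cost together with [s j z1] is at most
   [s j z]. *)
pose z1 := z - k.
suff [v2 cfg2 le_v2] : exists2 v2, config r.+1 j (piece_below j e + p' - z1) v2 &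
    value_below j e + v' <= v2 + s j z1.
  exists v2; first by have <- : piece_below j e + p' - z1 = p - z by lia.
  have := @s_top j (e - b j) k z lt_jt (ltnW lt_kz); rewrite -capE => /(_ le_zcap).
  by rewrite -/z1; lia.
case: (posnP (e - b j)) => [d2_0|d2_gt0].
  have d0 : d = 0 by lia.
  rewrite d0 N0 // in le_zN.
  have bE : piece_below j e = 0 by rewrite /piece_below d2_0 below0.
  have [|v1 cfg1 le_v1] := rem _ _ z1 cfg; first by rewrite /z1; lia.
  have [||v2 cfg2 v2E] := @config_stage r j e 0 _ _ (leq0n _) cfg1 _; try lia.
    rewrite ge_below_small //; try lia.
    by have := @b_mono j; lia.
  exists v2; last by rewrite subn0 in v2E; lia.
  by have <- : piece_below j e + 0 + (p' - z1) = piece_below j e + p' - z1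
    by rewrite /z1; lia.
case: e => [|e] in le_k pE vE le_p' kP le_be le_d capE le_zcap d2_gt0 *; first by lia.
have cap0E : piece_at j e = N j (e - b j).
  by rewrite /piece_at; case: leqP => //; lia.
rewrite piece_belowS value_belowS.
have le_e := @ge_below_le r j.+1 e e.+1 (leqnSn _).
case: (leqP z1 (piece_at j e)) => [le_z1|lt_z1].
  have [|||v2 cfg2 v2E] := @config_stage r j e (piece_at j e - z1) _ _ _ cfg;
    try lia.
  exists v2; last by rewrite subKn // in v2E; lia.
  by have <- : piece_below j e + (piece_at j e - z1) + p' =
     piece_below j e + piece_at j e + p' - z1 by lia.
have dE : d = (e - b j).+1.
  apply/eqP; rewrite eqn_leq; apply/andP; split; first lia.
  rewrite leqNgt; apply/negP => lt_d.
  have := @N_le j d (e - b j) lt_jt ltac:(lia); rewrite /z1 in lt_z1; lia.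
have eE : e.+1 - b j = d by lia.
rewrite /piece_below eE in pE.
have r_gt0 : 0 < r.
  by case: (r) cfg => //= -[p'0 _]; lia.
have lt_jt' : j.+1 < t by lia.
pose zk := z1 - piece_at j e.
have below_d : below j.+1 d = piece_at j e by rewrite dE below_child // cap0E.
have [||v1 cfg1 le_v1] := remc r_gt0 _ _ d zk cfg.
- by rewrite dE NS // -dE -cap0E in le_zN; rewrite /zk /z1; lia.
- by rewrite below_d /zk /z1; lia.
(* At least [N j (e - b j)] monomials stay in [U^(>j)], and this is enough for the ladder condition
   in degree [e]. *)
have := @ge_below_bound r j (e - b j) rj; rewrite -cap0E.
have -> : b j + (e - b j) = e by lia.
move=> lt_ge.
have [||v2 cfg2 v2E] := @config_stage r j e 0 _ _ (leq0n _) cfg1; try lia.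
exists v2.
  by have <- : piece_below j e + 0 + (p' - zk) =
    piece_below j e + piece_at j e + p' - z1 by rewrite /zk /z1; lia.
have -> : z1 = N j (e - b j) + zk by rewrite -cap0E /zk; lia.
rewrite sS //; last first.
  by rewrite dE NS // -cap0E in le_zN; rewrite /zk /z1; lia.
by rewrite -cap0E; rewrite subn0 in v2E; lia.
Qed.

(** [removable_low] covers [d <= e - b j], where [e] is the first degree not filled. The size
    condition leaves only [d = e - b j + 1], which completing degree [e] reduces to the first
    case. *)
Lemma removableP r j : r + j = t -> removable r j.
Proof.
elim/ltn_ind: r j => -[|r] IHr j rj p v d z.
  by move=> [-> ->] _ le0; exists 0.
have lt_jt : j < t by lia.
have rems r' j' : r' + j'.+1 = t -> j <= j' -> removable_parent r' j'.
  by move=> rj' le_jj'; apply: removable_parent_of => // _; apply: IHr; lia.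
have rj' : r + j.+1 = t by lia.
have remc : 0 < r -> removable r j.+1 by move=> _; apply: IHr.
move=> cfg le_zN le_zp.
case: (posnP z) => [->|z_gt0]; first by exists v; rewrite ?subn0 ?s0 ?addn0.
have low e v1 p1 z1 : config r.+1 j p1 v1 -> ge_below r.+1 j e.+1 <= p1 ->
    d = (e - b j).+1 -> b j <= e ->
    0 < z1 -> z1 <= N j d -> z1 + below j d <= p1 ->
  exists2 v2, config r.+1 j (p1 - z1) v2 & v1 <= v2 + s j z1.
- move=> cfg1 le_p1 dE le_be z1_gt0 le_z1N le_z1p.
  have [e1 [k [p' [v' [le_k pE vE cfg' [le_p' kP lt_p2 le_p2 le_be1]]]]]] :=
    normal_form rj' (rems _ _ rj' (leqnn j)) cfg1.
  have lt_e : e < e1.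
    rewrite ltnNge; apply/negP => le_e1.
    have := @ge_below_le r.+1 j e1.+1 e.+1 le_e1; lia.
  by apply: (removable_low rj' (rems _ _ rj' (leqnn j)) remc le_k pE vE cfg'
    le_p' kP le_be1 z1_gt0 le_z1N le_z1p); lia.
have [e [k [p' [v' [le_k pE vE cfg' [le_p' kP lt_p1 le_p1 le_be]]]]]] :=
  normal_form rj' (rems _ _ rj' (leqnn j)) cfg.
case: (leqP d (e - b j)) => [le_d|lt_d].
  by apply: (removable_low rj' (rems _ _ rj' (leqnn j)) remc le_k pE vE cfg'
    le_p' kP le_be z_gt0 le_zN le_zp le_d).
have lt_below : ge_below r.+1 j e.+1 <= below j (e - b j).+2.
  rewrite /= belowS /piece_below subSn //.
  have := @ge_below_bound r j (e - b j).+1 rj'.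
  have -> : b j + (e - b j).+1 = e.+1 by lia.
  lia.
have dE : d = (e - b j).+1.
  case: (ltngtP d (e - b j).+1) => // [|lt_d']; first lia.
  have := @below_le j _ _ lt_d'; lia.
(* Fill degree [e] first, and remove a correspondingly longer segment. *)
have [z2 [z2_gt0 le_z2 le_pz2 z2P]] := add_degree rj rems cfg le_p1 lt_p1.
have {}le_z2 : z2 <= N j d by rewrite dE; apply: leq_trans le_z2 (ge_at_bound rj le_be).
case: (leqP (z + z2) (N j d)) => [le_zz2|lt_zz2].
  have [v3 cfg3 le_v3] := z2P z2 (leqnn _); rewrite subnn s0 in le_v3.
  have [||||||v4 cfg4 le_v4] := low e _ _ (z + z2) cfg3 => //; try lia.
  exists v4; first by have <- : p + z2 - (z + z2) = p - z by lia.
  by have := s_sub j z z2; lia.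
(* The longer segment does not fit into degree [d]. Only [N j d - z] monomials are added, so that a
   whole degree is removed, and [s_top] compares the values. *)
have [|v3 cfg3 le_v3] := z2P (N j d - z); first lia.
have := @s_top j d (N j d - z) z2 lt_jt ltac:(lia) le_z2; rewrite subKn // => le_s.
have le_pN : N j d + below j d <= p + (N j d - z) by lia.
have [|v4 cfg4 le_v4] :=
    low e _ _ (N j d) cfg3 _ dE le_be (N_gt0 d lt_jt) (leqnn _) le_pN.
  by rewrite -dE belowS in lt_below; lia.
exists v4; last by lia.
by have <- : p + (N j d - z) - N j d = p - z by lia.
Qed.

Lemma removable_parentP r j : r + j.+1 = t -> removable_parent r j.
Proof. by move=> rj; apply: removable_parent_of => // _; apply: removableP. Qed.

(** * Adding monomials to a ladder set *)

Definition addable r i := forall p v z m, config r i.+1 p v -> p < z ->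
  z <= N i m -> exists2 v', config r i.+1 (p + N i m - z) v' &
    v + s i (N i m) <= v' + s i z.

Lemma addableP r i : 0 < r -> r + i.+1 = t -> addable r i.
Proof.
elim: r i => // r IHr i _ ri p v z m; move jE : i.+1 => j.
have [n len] : exists n, N i m - z <= n by exists (N i m - z).
elim: n p v z len => [|n IHn] p v z len cfg lt_pz le_zN.
  have -> : z = N i m by lia.
  by exists v; rewrite ?addnK.
case: (ltnP z (N i m)) => [lt_zN|]; last first.
  move=> le_Nz; have -> : z = N i m by lia.
  by exists v; rewrite ?addnK.
have lt_it : i.+1 < t by lia.
have lt_jt : j < t by rewrite -jE.
have rj : r + j.+1 = t by lia.
have [|d [z' [zE lt_z']]] := split_block_lt lt_it (z := z); first lia.
have [D DE] : exists D, D = d.+1 by exists d.+1.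
rewrite -DE jE in lt_z'.
have s_par x : x <= N j D -> s i (N i d + x) = s i (N i d) + s j x.
  by rewrite DE -jE; apply: sS.
have NiD : N i D = N i d + N j D by rewrite DE -jE; apply: NS.
have le_NiD : N i D <= N i m.
  rewrite DE; apply: N_le; first lia.
  rewrite ltnNge; apply/negP => le_md.
  have := @N_le i m d ltac:(lia) le_md; lia.
(* It is enough to add some [u > 0] monomials; the rest follows by induction with [z + u] in place
   of [z]. *)
suff [u [u_gt0 le_u [v3 cfg3 le_v3]]] : exists u, [/\ 0 < u, z' + u <= N j D &
    exists2 v3, config r.+1 j (p + u) v3 & v + s j (z' + u) <= v3 + s j z'].
  have [|||v4 cfg4 le_v4] := IHn _ _ (z + u) _ cfg3; try lia.
  exists v4; first by have <- : p + u + N i m - (z + u) = p + N i m - z by lia.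
  by rewrite zE -addnA s_par // in le_v4; rewrite zE s_par; lia.
have rem : removable_parent r j by apply: removable_parentP.
have rj1 : r.+1 + j = t by lia.
(* The gain provided by [add_degree] is compared with the increase of [s j] after [z']: by [s_sub]
   if all [z2] monomials fit into the degree, by [s_top] if only [N j D - z'] do. *)
have fill z2 : 0 < z2 -> z2 <= N j D ->
    (forall u, u <= z2 -> exists2 v3, config r.+1 j (p + u) v3 &
       v + s j z2 <= v3 + s j (z2 - u)) ->
  exists u, [/\ 0 < u, z' + u <= N j D &
    exists2 v3, config r.+1 j (p + u) v3 & v + s j (z' + u) <= v3 + s j z'].
- move=> z2_gt0 le_z2 z2P; case: (leqP (z' + z2) (N j D)) => h.
    exists z2; split=> //; have [v3 cfg3] := z2P _ (leqnn z2).
    rewrite subnn s0 => le_v3; exists v3 => //.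
    by have := s_sub j z' z2; lia.
  exists (N j D - z'); split; try lia.
  have [|v3 cfg3 le_v3] := z2P (N j D - z'); first lia.
  exists v3 => //.
  have := @s_top j D (N j D - z') z2 lt_jt ltac:(lia) le_z2.
  by rewrite subKn ?subnKC //; lia.
have [e [k [p' [v' [le_k pE vE cfg' [le_p' kP lt_p1 le_p1 le_be]]]]]] :=
  normal_form rj rem cfg.
have le_eD : e - b j <= D.
  rewrite leqNgt; apply/negP => lt_De.
  have := @below_le j _ _ lt_De.
  by rewrite belowS {1}DE -jE below_child // jE -NiD; rewrite /piece_below in pE; lia.
case: (ltnP (e - b j) D) => [lt_eD|le_De].
  have [z2 [z2_gt0 le_z2 _ z2P]] :=
    add_degree rj1 (fun r' j' H _ => removable_parentP H) cfg le_p1 lt_p1.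
  apply: (fill z2) => //; apply: leq_trans le_z2 _.
  by apply: leq_trans (ge_at_bound rj1 le_be) _; apply: N_le.
have eE : e - b j = D by lia.
have capE : piece_at j e = N j D by rewrite /piece_at le_be eE.
case: (leqP (ge_below r j.+1 e.+1) p') => [le_p'1|lt_p'1].
  have lt_p2 : p < piece_below j e.+1 + ge_below r j.+1 e.+1 by [].
  rewrite piece_belowS in lt_p2.
  apply: (fill (piece_at j e - k)); try lia.
  move=> u le_u.
  have [||v2 cfg2 v2E] := @config_stage r j e (k + u) _ _ _ cfg' le_p'; try lia.
  exists v2; first by have <- : piece_below j e + (k + u) + p' = p + u by lia.
  have -> : piece_at j e - k - u = piece_at j e - (k + u) by lia.
  lia.
have k0 : k = 0 by lia.
subst k; rewrite subn0 in vE.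
have r_gt0 : 0 < r by case: (r) lt_p'1.
(* Both sizes begin with [N i d], so [p < z] becomes [p' < z'], and the monomials can be added
   inside [U^(>j)]. *)
have belowE : piece_below j e = N i d by rewrite /piece_below eE DE -jE below_child.
have [||v1 cfg1 le_v1] := IHr j r_gt0 rj p' v' z' D cfg'; try lia.
exists (N j D - z'); split; try lia.
have [||v2 cfg2 v2E] := @config_stage r j e 0 _ _ (leq0n _) cfg1; try lia.
exists v2.
  by have <- : piece_below j e + 0 + (p' + N j D - z') = p + (N j D - z') by lia.
by rewrite subnKC ?(ltnW lt_z') // subn0 in v2E *; lia.
Qed.

(* The admissibility of [f] depends only on the number [z] of monomials above [f]
   in its degree: if [rho f] is [delta i.+1] times a monomial of degree [d.+1]
   with [z'] monomials above it, then [z = N i d + z']. *)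
Fixpoint admissible_gap r i e z : Prop :=
  if r is r'.+1 then z = 0 \/ exists d z', [/\ z = N i d + z',
    z' < N i.+1 d.+1, d.+1 + b i.+1 <= e.+1,
    r' = 0 -> d.+1 + b i.+1 <= e \/ z' = 0 & admissible_gap r' i.+1 e z']
  else True.

Lemma admissible_gap0 r i e : admissible_gap r i e 0.
Proof. by case: r => //= r; left. Qed.

(** [N i d] is [below i.+1 d.+1], the part of [U^(i+1)] below the degree of [rho f]. The other [z']
    are fewer than the monomials of [U^(i+1)] in that degree if it is at most [e], and are bounded
    inside [U^(>i+1)] by induction if it is [e.+1]; when no piece is left, [z'] is then 0. *)
Lemma admissible_gap_le r i e z : 0 < r -> r + i.+1 = t ->
  admissible_gap r i e z -> z <= ge_below r i.+1 e.+1.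
Proof.
elim: r i z => // r IHr i z _ ri [->//|[d [z' [-> lt_z' le_d r0P adm']]]].
have lt_it : i.+1 < t by lia.
rewrite /= /piece_below -(below_child d lt_it).
case: (ltnP d.+1 (e.+1 - b i.+1)) => [lt_d|ge_d].
  have := @below_le i.+1 _ _ lt_d; rewrite (belowS _ d.+1); lia.
have -> : e.+1 - b i.+1 = d.+1 by lia.
rewrite leq_add2l; case: (posnP r) => [r0|r_gt0]; first by case: (r0P r0); lia.
by apply: IHr => //; lia.
Qed.

(* [z] and [w] are the numbers of monomials missing from a degree of [U^(i)]. *)
Lemma optimal_gap r i m e z p v : r + i.+1 = t -> z <= N i m ->
  config r i.+1 p v -> ge_below r i.+1 e.+1 <= p ->
  exists w v', [/\ w = N i m \/ admissible_gap r i e w /\ w < N i m,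
    config r i.+1 (p + w - z) v' /\ v + s i w <= v' + s i z,
    z + ge_below r i.+1 e.+1 <= p + w,
    z <= p -> ge_below r i.+1 e.+1 < N i m -> w <= ge_below r i.+1 e.+1 &
    forall w', admissible_gap r i e w' -> w' < w ->
      p + w' < z + ge_below r i.+1 e.+1].
Proof.
elim: r i m z p v => [|r IHr] i m z p v ri le_zN cfg le_p.
  case: (cfg) => p0 v0; exists z, v; split=> [|||h _|w' _] /=.
  - by case: (ltngtP z (N i m)) => [lt_z|lt_z|->]; [right|lia|left].
  - by rewrite addnK p0 v0.
  - by lia.
  - by lia.
  - by lia.
move jE : i.+1 => j in cfg le_p *.
have lt_it : i.+1 < t by lia.
have lt_jt : j < t by rewrite -jE.
have rj : r + j.+1 = t by lia.
have rj1 : r.+1 + j = t by lia.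
have adm_le w : admissible_gap r.+1 i e w -> w <= ge_below r.+1 j e.+1.
  by move=> /(admissible_gap_le (ltn0Sn r) ri); rewrite jE.
set G := ge_below r.+1 j e.+1 in le_p adm_le *.
(* More monomials are missing than [U^(>i)] contains, so the degree of [U^(i)] is emptied. No
   admissible gap is large enough, since these are at most [G]. *)
have [lt_pz|] : p < z \/ z <= p by lia.
  have [|v' cfg' le_v'] := @addableP r.+1 i isT ri p v z m _ lt_pz le_zN.
    by rewrite jE.
  rewrite jE in cfg'; exists (N i m), v'; split=> //; try lia.
  by move=> w' /adm_le; lia.
elim/ltn_ind: z p v le_zN cfg le_p => z IHz p v le_zN cfg le_p le_zp.
case: (posnP z) => [z0|z_gt0].
  exists 0, v; rewrite z0 addn0 subn0; split=> //; try lia.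
  by right; split; [left | apply: N_gt0; lia].
(* While enough monomials are left, [z2] of them move from [U^(>i)] into the gap, and what remains
   of it, [z1], is treated by induction. *)
have step d' z1 z2 : z = z1 + z2 -> 0 < z2 -> z2 <= N j d' ->
    below j d' = z1 -> s i z1 + s j z2 <= s i z -> z2 + G <= p ->
  exists w v', [/\ w = N i m \/ admissible_gap r.+1 i e w /\ w < N i m,
    config r.+1 j (p + w - z) v' /\ v + s i w <= v' + s i z,
    z + G <= p + w, z <= p -> G < N i m -> w <= G &
    forall w', admissible_gap r.+1 i e w' -> w' < w -> p + w' < z + G].
- move=> zE z2_gt0 le_z2 bE le_s le_Gp.
  have [||v1 cfg1 le_v1] := @removableP r.+1 j rj1 p v d' z2 cfg; try lia.
  have [||||w [v2 [wP [cfg2 le_v2] le_pw w_le w_min]]] := IHz z1 _ (p - z2) v1 _ cfg1;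
    try lia.
  exists w, v2; split=> //; try lia.
  - split; first by have <- : p - z2 + w - z1 = p + w - z by lia.
    by rewrite zE in le_s *; lia.
  - by move=> w' w'P lt_w'; have := w_min w' w'P lt_w'; lia.
case: (leqP z 1) => [le_z1|lt_1z].
  have z1 : z = 1 by lia.
  case: (leqP (1 + G) p) => [le_Gp|lt_pG].
    apply: (step 0 0 1) => //; rewrite ?z1 ?below0 ?N0 ?s0 //.
    by rewrite add0n -jE; apply: s1.
  exists 1, v; rewrite z1; split=> //; try lia.
  - case: (ltngtP 1 (N i m)) => [lt1|lt1|]; last by left.
      right; split=> //; right; exists 0, 0; rewrite N0; last lia.
      split=> //; try by [apply: N_gt0|right|apply: admissible_gap0].
      rewrite jE; case: (leqP (b j) e) => // lt_eb.
      by move: le_zp; have -> : p = 0; last lia; have : G = 0;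
        [apply: ge_below_small; lia|lia].
    by have := N_gt0 m (ltnW lt_it); lia.
  - by rewrite addnK.
have [d [zj [zE zj_gt0 le_zj]]] := split_block_pos lt_it lt_1z.
rewrite jE in le_zj.
have bE : below j d.+1 = N i d by rewrite -jE below_child.
have s_par x : x <= N j d.+1 -> s i (N i d + x) = s i (N i d) + s j x.
  by rewrite -jE; apply: sS.
have NiS d1 : N i d1.+1 = N i d1 + N j d1.+1 by rewrite -jE; apply: NS.
case: (leqP (zj + G) p) => [le_Gp|lt_pG].
  by apply: (step d.+1 (N i d) zj) => //; rewrite zE s_par.
pose c := e.+1 - b j.
have GE : G = below j c + ge_below r j.+1 e.+1 by [].
(* Since [N i d + zj <= p < zj + G], it suffices that [d >= c] would force [G <= N i d]; this comes
   from [ge_below_bound] for [c]. *)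
have le_dc : d.+1 <= c.
  rewrite leqNgt; apply/negP => lt_cd.
  have le_be1 : b j <= e.+1 \/ G = 0.
    case: (leqP (b j) e.+1) => h; [by left|right].
    by apply: ge_below_small => //; lia.
  have lt_G : G < N i d + 1.
    case: le_be1 => [le_be|->]; last by lia.
    have := @ge_below_bound r j c rj.
    have -> : b j + c = e.+1 by rewrite /c; lia.
    have := @below_le j _ _ lt_cd.
    by rewrite bE belowS GE; lia.
  lia.
have le_be : b j <= e by rewrite /c in le_dc; lia.
have [e2 [k [p' [v' [le_k pE vE cfg' [le_p' kP lt_p1 le_p1 le_be2]]]]]] :=
  normal_form rj (removable_parentP rj) cfg.
have le_zjc : zj <= N j c by apply: leq_trans le_zj _; apply: N_le.
have capE : piece_at j e.+1 = N j c by rewrite /piece_at leqW.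
have GSE : ge_below r.+1 j e.+2 = G + ge_at r.+1 j e.+1 by apply: ge_belowS.
have e2E : e2 = e.+1.
  case: (ltngtP e2 e.+1) => // h.
    by have := @ge_below_le r.+1 j _ _ h; rewrite -/G; lia.
  by have := @ge_below_le r.+1 j _ _ h; rewrite GSE /= capE; lia.
subst e2.
rewrite capE in le_k vE.
have pbE : piece_below j e.+1 = below j c by [].
rewrite pbE in pE.
have lt_kz : k < zj.
  by case: (posnP k) => [->//|/kP le_p'2];
    have := @ge_below_le r j.+1 _ _ (leqnSn e.+1); lia.
(* The [k] monomials of [U^(j)_(e+1)] move into the gap, and the remaining [zj - k] are exchanged
   with [U^(>j)] by induction. By [s_top], a bottom segment of the larger degree [c] costs no more
   than it gains in the gap. *)
have [|w [v2 [wP [cfg2 le_v2] le_pw w_le w_min]]] :=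
  IHr j d.+1 (zj - k) p' v' rj _ cfg' le_p'; first lia.
have [||v3 cfg3 v3E] := config_stage (leq0n (piece_at j e.+1)) cfg2; try lia.
rewrite pbE in cfg3; rewrite subn0 capE in v3E.
have le_bc : N i d <= below j c by rewrite -bE; apply: below_le.
have lt_dm : d < m.
  rewrite ltnNge; apply/negP => le_md.
  have := @N_le i m d ltac:(lia) le_md; lia.
have le_Nm : N i d.+1 <= N i m by apply: N_le; lia.
have le_wN : w <= N j d.+1 by case: wP => [->|[_]]; lia.
(* For [d.+1 = c] the image under [rho] has degree [e.+1], the largest one allowed; the bound on [w]
   keeps it inside its block, and makes it 0 if no piece follows. *)
have dcP : d.+1 < c \/ d.+1 = c /\ w <= ge_below r j.+1 e.+1.
  case: (ltngtP d.+1 c) => [h|h|dE]; [by left|by lia|right; split=> //].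
  apply: w_le; first by move: pE; rewrite -dE bE; lia.
  rewrite dE; have := @ge_below_bound r j c rj.
  by have -> : b j + c = e.+1 by rewrite /c; lia.
have adm_d x : d.+1 < c -> x < N j d.+2 -> x = 0 ->
    admissible_gap r.+1 i e (N i d.+1 + x).
  move=> lt_dc lt_x x0; right; exists d.+1, x; rewrite jE; split=> //.
  - by rewrite /c in lt_dc; lia.
  - by right.
  - by rewrite x0; apply: admissible_gap0.
exists (N i d + w), v3; split.
- case: wP => [wE|[w_adm lt_w]].
    case: (ltngtP d.+1 m) => [lt_dm1|//|<-]; last by left; rewrite wE NiS.
      right; split; last first.
        rewrite wE -NiS; apply: leq_trans (N_le _ lt_dm1); try lia.
        by rewrite (NiS d.+1); have := N_gt0 d.+2 lt_jt; lia.
      rewrite wE -NiS -[N i d.+1]addn0; apply: adm_d => //.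
        case: dcP => // -[dE w_le1].
        have := @ge_below_bound r j c rj.
        have -> : b j + c = e.+1 by rewrite /c; lia.
        by rewrite -dE; lia.
      by apply: N_gt0.
    by lia.
  right; split; last by rewrite NiS in le_Nm; lia.
  right; exists d, w; rewrite jE; split=> //; first by rewrite /c in le_dc; lia.
  move=> r0; case: dcP => [lt_dc|[_]]; first by left; rewrite /c in lt_dc; lia.
  by rewrite r0 /= leqn0 => /eqP; right.
- split; first by have <- : below j c + 0 + (p' + w - (zj - k)) =
    p + (N i d + w) - z by lia.
  have sz := @s_top j c k zj lt_jt (ltnW lt_kz) le_zjc.
  by rewrite zE !s_par //; lia.
- lia.
- move=> _ _; case: dcP => [lt_dc|[dE w_le1]]; last by rewrite GE -dE bE; lia.
  have := @below_le j _ _ lt_dc; rewrite belowS bE GE; lia.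
- move=> w' w'_adm lt_w'.
  (* A gap below [N i d] is too small because [p < zj + G]; any other one has the same [d], and [w]
     is minimal for the second part. *)
  case: (ltnP w' (N i d)) => [|le_w']; first by lia.
  case: (w'_adm) => [w'0|[d1 [w1 [w'E lt_w1 le_d1 r0P w1_adm]]]].
    by have := N_gt0 d (ltnW lt_it); lia.
  have d1E : d1 = d.
    case: (ltngtP d1 d) => // h.
      have := @N_le i d1.+1 d (ltnW lt_it) h; rewrite NiS -jE; lia.
    have := @N_le i d.+1 d1 (ltnW lt_it) h; rewrite NiS; lia.
  subst d1; rewrite jE in w1_adm.
  have := w_min w1 w1_adm ltac:(lia); lia.
Qed.

(* [k] is the rank from below, in [U^(j)_e], of a candidate for [f_j]. *)
Definition fits r j p e k := [/\ 0 < k, k <= piece_at j e,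
  admissible_gap r j e (piece_at j e - k) &
  piece_below j e + k + ge_below r j.+1 e.+1 <= p].

Fixpoint extremal r j p u : Prop :=
  if r is r'.+1 then
    (exists e k p' u', [/\ fits r' j p e k,
       forall e1 k1, fits r' j p e1 k1 -> e1 < e \/ e1 = e /\ k1 <= k,
       p = piece_below j e + k + p',
       u + s j (piece_at j e - k) = value_below j e + s j (piece_at j e) + u' &
       extremal r' j.+1 p' u'])
    \/ (forall e k, ~ fits r' j p e k) /\ extremal r' j.+1 p u
  else p = 0 /\ u = 0.

(** After [normal_form], [optimal_gap] changes the last degree of [U^(j)] without loss, until it is
    empty or has the smallest admissible gap that leaves [U^(>j)] large enough. This is the choice
    made in [extremal]; the later pieces are compared by induction. *)
Theorem config_le_extremal r j p v u : r + j = t ->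
  config r j p v -> extremal r j p u -> v <= u.
Proof.
elim: r j p v u => [|r IHr] j p v u rj cfg ext.
  by case: cfg ext => _ -> [_ ->].
have rj1 : r + j.+1 = t by lia.
have {}IHr := IHr j.+1 _ _ _ rj1.
have [e [k [p' [v' [le_k pE vE cfg' [le_p' kP lt_p1 le_p1 le_be]]]]]] :=
  normal_form rj1 (removable_parentP rj1) cfg.
have capE : piece_at j e = N j (e - b j) by rewrite /piece_at le_be.
have fits_le e1 k1 : fits r j p e1 k1 -> e1 <= e.
  case=> k1_gt0 _ _ le_p; rewrite leqNgt; apply/negP => lt_e.
  have := @ge_below_le r.+1 j _ _ lt_e => /=; have := @ge_below_le r j.+1 _ _ (leqnSn e1).
  move: lt_p1 => /=; lia.
(* Without a candidate in degree [e], the extremal set fills exactly the degrees of [U^(j)] below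
   [e]: the gap 0 is admissible in degree [e - 1], and the size condition there is
   [ge_below r.+1 j e <= p]. *)
have no_fit p1 v1 : (forall k1, ~ fits r j p e k1) -> config r j.+1 p1 v1 ->
    p = piece_below j e + p1 -> v <= value_below j e + v1 -> v <= u.
- move=> nofit cfg1 p1E v1E; case: (ltnP (b j) e) => [lt_be|ge_be].
    case: e {cfg' kP le_p' vE pE} => // e in lt_be le_k lt_p1 le_p1 le_be capE
      fits_le nofit p1E v1E *.
    have fit0 : fits r j p e (piece_at j e).
      split=> //.
      - by rewrite /piece_at ifT // N_gt0 //; lia.
      - by rewrite subnn; apply: admissible_gap0.
      - by rewrite -piece_belowS; apply: le_p1.
    case: ext => [[e1 [k1 [p2 [u2 [fit1 max1 p2E u2E ext2]]]]]|[/(_ _ _ fit0)//]].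
    have e1E : e1 = e.
      case: (max1 _ _ fit0) => [lt_e1|[<- //]].
      have := fits_le _ _ fit1; case: ltngtP => // e1E _;
        last by move: fit1; rewrite e1E => /nofit.
      lia.
    subst e1; have [_ le_k1 _ _] := fit1.
    have k1E : k1 = piece_at j e by case: (max1 _ _ fit0) => [|[_]]; lia.
    rewrite k1E subnn s0 in u2E; rewrite piece_belowS in p1E.
    have {}p2E : p2 = p1 by lia.
    rewrite p2E in ext2; have := IHr _ _ _ cfg1 ext2.
    by rewrite value_belowS in v1E; lia.
  have eE : e - b j = 0 by lia.
  have pb0 : piece_below j e = 0 by rewrite /piece_below eE below0.
  have vb0 : value_below j e = 0 by rewrite /value_below eE big_ord0.
  case: ext => [[e1 [k1 [p2 [u2 [fit1 _ _ _ _]]]]]|[_ ext1]].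
    have := fits_le _ _ fit1; rewrite leq_eqVlt => /orP[/eqP e1E|lt_e1].
      by move: fit1; rewrite e1E => /nofit.
    case: fit1 => k1_gt0 + _ _; rewrite /piece_at ifF; lia.
  rewrite vb0 add0n in v1E; apply: leq_trans v1E (IHr _ _ _ cfg1 _).
  by rewrite pb0 add0n in p1E; rewrite -p1E.
case: (leqP (ge_below r j.+1 e.+1) p') => [le_p'1|lt_p'1]; last first.
  have k0 : k = 0 by lia.
  subst k; rewrite subn0 addn0 in vE pE.
  by apply: (no_fit p' v') => //; [move=> k1 [_ _ _]; lia|lia].
have [|w [v1 [wP [cfg1 le_v1] le_w _ w_min]]] :=
  @optimal_gap r j (e - b j) e (piece_at j e - k) p' v' rj1 _ cfg' le_p'1.
  by rewrite -capE leq_subr.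
have fit_min k1 : fits r j p e k1 -> w <= piece_at j e - k1.
  case=> k1_gt0 le_k1 adm1 le_p; rewrite leqNgt; apply/negP => lt_w.
  by have := w_min _ adm1 lt_w; lia.
case: wP => [wE|[w_adm lt_w]].
  rewrite -capE in wE; apply: (no_fit (p' + w - (piece_at j e - k)) v1) => //; try lia.
  - by move=> k1 fit1; have := fit_min _ fit1; case: fit1; lia.
  - by rewrite wE in le_v1; lia.
rewrite -capE in lt_w.
have fitw : fits r j p e (piece_at j e - w).
  by split; rewrite ?subKn // ?(ltnW lt_w) //; lia.
case: ext => [[e1 [k1 [p2 [u2 [fit1 max1 p2E u2E ext2]]]]]|[/(_ _ _ fitw)//]].
have e1E : e1 = e.
  by have := fits_le _ _ fit1; case: (max1 _ _ fitw) => [|[<-//]]; lia.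
subst e1; have := fit_min _ fit1; have [_ le_k1 _ _] := fit1 => le_w1.
have k1E : k1 = piece_at j e - w by case: (max1 _ _ fitw) => [|[_]]; lia.
have p2E' : p2 = p' + w - (piece_at j e - k) by lia.
rewrite p2E' in ext2; have := IHr _ _ _ cfg1 ext2.
by rewrite k1E subKn in u2E; lia.
Qed.

(** The [q] lex-smallest monomials of degree [D] move down into the gap of degree [e]. If they fit,
    [s_top] shows that nothing is lost. Otherwise the gap is filled, [s_sub] compares the monomials
    used for it, and degree [e.+1] comes next. *)
Lemma merge_degree j e D k q : j < t -> e <= D -> (e = D -> k = 0) ->
  k <= piece_at j e -> q <= piece_at j D ->
  exists e2 k2, [/\ e2 <= D, k2 <= piece_at j e2,
    piece_below j e + k + q = piece_below j e2 + k2 &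
    value_below j e + s j (piece_at j e) + s j (piece_at j D)
      + s j (piece_at j e2 - k2) <=
    value_below j e2 + s j (piece_at j e2) + s j (piece_at j e - k)
      + s j (piece_at j D - q)].
Proof.
move=> lt_jt; have [m mE] : exists m, D - e = m by exists (D - e).
elim: m e k q mE => [|m IHm] e k q mE le_eD k0 le_k le_q.
  have eD : e = D by lia.
  have k_0 := k0 eD; subst e k; exists D, q; split=> //; first by lia.
  by rewrite subn0; lia.
case: (leqP q (piece_at j e - k)) => [le_qm|lt_mq].
  exists e, (k + q); split=> //; try lia.
  case: (leqP (b j) e) => [le_be|lt_eb]; last first.
    have cap0 : piece_at j e = 0 by rewrite /piece_at leqNgt lt_eb.
    rewrite cap0 in le_k le_qm *.
    have -> : k = 0 by lia.
    have -> : q = 0 by lia.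
    by rewrite !subn0; lia.
  have capE : piece_at j e = N j (e - b j) by rewrite /piece_at le_be.
  have capDE : piece_at j D = N j (D - b j).
    by rewrite /piece_at (leq_trans le_be le_eD).
  rewrite capE in le_k le_qm; rewrite capDE in le_q; rewrite capE capDE.
  have le_N := @N_le j _ _ lt_jt (leq_sub2r (b j) le_eD).
  have := @s_top j (D - b j) q (N j (e - b j) - k) lt_jt le_qm ltac:(lia).
  have -> : N j (e - b j) - k - q = N j (e - b j) - (k + q) by lia.
  lia.
have [|||||e2 [k2 [le_e2 le_k2 pE vE]]] :=
  IHm e.+1 0 (q - (piece_at j e - k)); try lia.
exists e2, k2; split=> //; first by rewrite piece_belowS in pE; lia.
rewrite subn0 value_belowS in vE.
have := s_sub j (piece_at j D - q) (piece_at j e - k).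
have -> : piece_at j D - q + (piece_at j e - k) =
  piece_at j D - (q - (piece_at j e - k)) by lia.
lia.
Qed.

(** Degrees are merged one at a time, in increasing order. The last alternative records a degree
    [e' >= e] in which the original set is not empty; the ladder condition will be read off
    there. *)
Lemma collect_degrees j D (size_at value_at : nat -> nat) : j < t ->
  (forall e, size_at e <= piece_at j e) ->
  (forall e, value_at e + s j (piece_at j e - size_at e) = s j (piece_at j e)) ->
  exists e k, [/\ k <= piece_at j e,
    \sum_(i < D) size_at i = piece_below j e + k,
    \sum_(i < D) value_at i + s j (piece_at j e - k)
      <= value_below j e + s j (piece_at j e) &
    e = 0 /\ k = 0 \/ exists2 e', e' < D & 0 < size_at e' /\ e <= e'].
Proof.
move=> lt_jt size_le valueE; elim: D => [|D [e [k [le_k pE vE eP]]]].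
  exists 0, 0; rewrite !big_ord0; split=> //; last by left.
  - by rewrite /piece_below sub0n below0.
  - by rewrite subn0; lia.
rewrite !big_ord_recr /=.
case: (posnP (size_at D)) => [D0|D_gt0].
  exists e, k; split=> //; first by rewrite D0 addn0.
    have -> : value_at D = 0 by have := valueE D; rewrite D0 subn0; lia.
    by rewrite addn0.
  case: eP => [|[e' lt_e' h]]; [by left|right; exists e' => //; lia].
have [||e2 [k2 [le_e2 le_k2 pE2 vE2]]] :=
  @merge_degree j e D k (size_at D) lt_jt _ _ le_k (size_le D).
- by case: eP => [[-> _]//|[e' lt_e' [_ le_e']]]; lia.
- by case: eP => [[_ ->]//|[e' lt_e' [_ le_e']]]; lia.
exists e2, k2; split=> //; first by rewrite pE.
  set V := \sum_(i < D) _ in vE *; have := valueE D; lia.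
by right; exists D.
Qed.

End Core.

(** * Top segments of lexicographically ordered monomials *)

(* [F x] sums the last [x] letters of a word with blocks of lengths
   [..., M 2, M 1, M 0], each ending in the same letters, whose sums are given by
   [f]: the monomials of degree [D] in [x_i, ...] fall into the blocks
   [x_i^(D - d)] times the monomials of degree [d] in [x_(i+1), ...]. *)
Section BlockSum.

Variables f F M : nat -> nat.
Let T d := \sum_(i < d) M i.

Hypothesis M_gt0 : forall d, 0 < M d.
Hypothesis M_mono : forall d d', d <= d' -> M d <= M d'.
Hypothesis f0 : f 0 = 0.
Hypothesis f_sub : forall x y, f (x + y) <= f x + f y.
Hypothesis f_top : forall d x y, x <= y -> y <= M d ->
  f (M d) + f (y - x) <= f y + f (M d - x).
Hypothesis F0 : F 0 = 0.
Hypothesis F_block : forall d x, x <= M d -> F (T d + x) = F (T d) + f x.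

Let TS d : T d.+1 = T d + M d. Proof. by rewrite /T big_ord_recr. Qed.
Let T0 : T 0 = 0. Proof. by rewrite /T big_ord0. Qed.

Let T_le d d' : d <= d' -> T d <= T d'.
Proof.
move=> /subnK <-; elim: (d' - d) => //= k IHk.
by rewrite addSn TS; lia.
Qed.

Let in_block y : 0 < y -> exists d q, [/\ y = T d + q, 0 < q & q <= M d].
Proof.
elim: y => // y IHy _; case: (posnP y) => [->|/IHy [d [q [-> q_gt0 le_q]]]].
  by exists 0, 1; rewrite T0.
case: (ltnP q (M d)) => h; first by exists d, q.+1; split; lia.
by exists d.+1, 1; rewrite TS; split=> //; lia.
Qed.

(** Induction on [x], the length of two intervals, one ending at [y] and one at the total length. A
    long interval is cut after [M d]. Otherwise the second one lies in a single block; [f_top]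
    applies if the first one does too, and else the induction hypothesis together with [f_sub]. *)
Lemma block_sum_top d x y : x <= y -> y <= \sum_(i < d) M i ->
  F (\sum_(i < d) M i) + F (y - x) <= F y + F (\sum_(i < d) M i - x).
Proof.
rewrite -/(T d).
elim/ltn_ind: x y d => x IHx y [|d] le_xy le_yT.
  by rewrite T0 in le_yT *; rewrite !sub0n; have -> : y = 0 by lia.
case: (posnP x) => [->|x_gt0]; first by rewrite !subn0; lia.
case: (leqP x (M d)) => [le_xM|lt_Mx]; last first.
  have h1 := IHx _ lt_Mx y d.+1 ltac:(lia) le_yT.
  have h2 := IHx (x - M d) ltac:(have := M_gt0 d; lia) (y - M d) d ltac:(lia)
    ltac:(rewrite TS in le_yT; lia).
  rewrite TS in h1 *.
  have e1 : T d + M d - M d = T d by lia.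
  have e2 : y - M d - (x - M d) = y - x by lia.
  have e3 : T d - (x - M d) = T d + M d - x by lia.
  rewrite e1 in h1; rewrite e2 e3 in h2; lia.
have [d1 [q [yE q_gt0 le_q]]] : exists d q, [/\ y = T d + q, 0 < q & q <= M d].
  by apply: in_block; lia.
have le_d1 : d1 <= d.
  rewrite leqNgt; apply/negP => lt_d; have := T_le lt_d; lia.
have FT z : z <= M d -> F (T d + M d - z) = F (T d) + f (M d - z).
  by move=> le_z; rewrite -addnBA // F_block //; lia.
rewrite TS F_block // FT //.
case: (leqP x q) => [le_xq|lt_qx].
  rewrite yE -addnBA // !F_block //; last lia.
  by have := f_top le_xq (leq_trans le_q (M_mono le_d1)); lia.
have h := IHx (x - q) ltac:(lia) (T d1) d.+1 ltac:(lia) ltac:(lia).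
rewrite TS F_block // FT in h; last lia.
have e1 : T d1 - (x - q) = y - x by lia.
rewrite e1 in h; rewrite [in F y]yE F_block //.
have := f_sub (M d - x) q.
have -> : M d - x + q = M d - (x - q) by lia.
lia.
Qed.

Lemma block_sum_sub x y : F (x + y) <= F x + F y.
Proof.
wlog le_xy : x y / x <= y.
  move=> IH; case: (leqP x y) => [|/ltnW] /IH //.
  by rewrite addnC [F y + _]addnC.
elim/ltn_ind: x y le_xy => a IHa y le_ay.
case: (posnP a) => [->|a_gt0]; first by rewrite F0.
have [k [c [aE c_gt0 le_c]]] := in_block a_gt0.
have [d1 [q [sE q_gt0 le_q]]] : exists d q, [/\ a + y = T d + q, 0 < q & q <= M d].
  by apply: in_block; lia.
case: (leqP (T d1) y) => [le_Ty|lt_yT].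
  have h := IHa (T k) ltac:(lia) (y + c) ltac:(lia).
  have e1 : T k + (y + c) = a + y by lia.
  have le_qc : y - T d1 + c <= M d1.
    by have := T_le (leq0n k); lia.
  have e2 : y + c = T d1 + (y - T d1 + c) by lia.
  have e3 : F y = F (T d1) + f (y - T d1).
    by rewrite -F_block; [congr F; lia|lia].
  rewrite e1 e2 F_block // in h.
  have := f_sub (y - T d1) c.
  by rewrite [in F a]aE F_block //; lia.
(* Of the length [a], a part [T d1 - y] completes [y] to the block boundary and is bounded by
   [block_sum_top], which uses [a <= y]; the rest is bounded by induction. *)
have h1 := @block_sum_top d1 (T d1 - y) a ltac:(lia) ltac:(rewrite -/(T d1); lia).
have h2 := IHa (a - (T d1 - y)) ltac:(lia) (T d1) ltac:(lia).
rewrite -/(T d1) in h1.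
have e1 : a - (T d1 - y) + T d1 = a + y by lia.
have e2 : T d1 - (T d1 - y) = y by lia.
rewrite e1 in h2; rewrite e2 in h1; lia.
Qed.

End BlockSum.

(** * Lists of monomials in lex order *)

Section Monomials.

Variable n : nat.
Implicit Types (u v w h : 'X_{1..n}) (i j d : nat).

Lemma lex_ltE u v : mdeg u = mdeg v -> lex_lt v u = (v < u)%O.
Proof.
move=> uv; apply/existsP/(ltmcP (esym uv)) => [[i /andP[lt_i /forallP eqj]]|[i eqj lt_i]].
  by exists i => // j lt_ji; apply/eqP; apply: implyP (eqj j) lt_ji.
exists i; rewrite lt_i; apply/forallP => j; apply/implyP => lt_ji.
by apply/eqP; apply: eqj.
Qed.

Lemma lex_lt_add w u v : lex_lt (w + v)%MM (w + u)%MM = lex_lt v u.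
Proof.
apply: eq_existsb => i; rewrite !mnmDE ltn_add2l; congr (_ && _).
by apply: eq_forallb => j; rewrite !mnmDE eqn_add2l.
Qed.

Definition xvar i : 'X_{1..n} := varpow n i 1.

Lemma xvarE i (j : 'I_n) : xvar i j = (j == i :> nat).
Proof. by rewrite mnmE; case: eqP. Qed.

Lemma mdeg_varpow i k : i < n -> mdeg (varpow n i k) = k.
Proof.
move=> lt_in; rewrite mdegE (bigD1 (Ordinal lt_in)) //= big1 ?mnmE ?eqxx ?addn0 //.
move=> j ne_ji; rewrite mnmE; case: eqP => // E.
by case/eqP: ne_ji; apply: val_inj.
Qed.

Lemma Smon_n u i : n <= i -> Smon i u = (u == 0%MM).
Proof.
move=> le_ni; apply/forallP/eqP => [u0|-> j]; last by rewrite mnm0E eqxx implybT.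
apply/mnmP=> j; rewrite mnm0E; apply/eqP; apply: (implyP (u0 j)).
exact: leq_trans (ltn_ord j) le_ni.
Qed.

Lemma SmonS (i : 'I_n) u : Smon i.+1 u = Smon i u && (u i == 0).
Proof.
apply/forallP/andP => [u0|[/forallP u0 ui0] j].
  split; last by apply: (implyP (u0 i)).
  by apply/forallP=> j; apply/implyP=> /ltnW lt_ji; apply: (implyP (u0 j)).
apply/implyP; rewrite ltnS leq_eqVlt => /orP[/eqP/val_inj->//|].
exact: (implyP (u0 j)).
Qed.

Lemma SmonD i u v : Smon i (u + v)%MM = Smon i u && Smon i v.
Proof.
apply/forallP/andP => [uv0|[/forallP u0 /forallP v0] j].
  by split; apply/forallP=> j; apply/implyP=> lt_ji;
    have := implyP (uv0 j) lt_ji; rewrite mnmDE addn_eq0 => /andP[].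
apply/implyP=> lt_ji; rewrite mnmDE addn_eq0.
by rewrite (implyP (u0 j) lt_ji) (implyP (v0 j) lt_ji).
Qed.

Lemma Smon_varpow i k j : j <= i -> Smon j (varpow n i k).
Proof.
move=> le_ji; apply/forallP=> l; apply/implyP=> lt_lj; rewrite mnmE.
by rewrite (ltn_eqF (leq_trans lt_lj le_ji)).
Qed.

(* Decreasing lex order. *)
Fixpoint mons_rec r : nat -> seq 'X_{1..n} :=
  if r is r'.+1 then
    fix aux d := if d is d'.+1 then
      [seq (xvar (n - r) + u)%MM | u <- aux d'] ++ mons_rec r' d
    else [:: 0%MM]
  else fun d => if d == 0 then [:: 0%MM] else [::].

Definition mons i d := mons_rec (n - i) d.

Lemma mons0 i : mons i 0 = [:: 0%MM].
Proof. by rewrite /mons; case: (n - i). Qed.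

Lemma monsS i d : i < n ->
  mons i d.+1 = [seq (xvar i + u)%MM | u <- mons i d] ++ mons i.+1 d.+1.
Proof.
move=> lt_in; rewrite /mons -(subnSK lt_in) /=.
by have -> : n - (n - i.+1).+1 = i by lia.
Qed.

Lemma mons_n i d : n <= i -> mons i d = if d == 0 then [:: 0%MM] else [::].
Proof. by rewrite /mons -subn_eq0 => /eqP->. Qed.

Lemma mem_mons i d u : (u \in mons i d) = Smon i u && (mdeg u == d).
Proof.
have [r nE] : exists r, n <= r + i by exists n; apply: leq_addr.
elim: r i nE d u => [|r IHr] i nE d u.
  rewrite mons_n // Smon_n // -mdeg_eq0.
  case: eqP => [->|d0]; first by rewrite inE -mdeg_eq0 andbb.
  rewrite in_nil; apply/esym/negbTE/negP => /andP[/eqP-> /eqP].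
  by move=> E; case: d0.
case: (ltnP i n) => [lt_in|le_ni]; last by apply: IHr; lia.
elim: d u => [|d IHd] u.
  rewrite mons0 inE -mdeg_eq0; apply/eqP/andP => [u0|[_ /eqP//]].
  split; last by apply/eqP.
  move/eqP: u0; rewrite mdeg_eq0 => /eqP->.
  by apply/forallP=> j; rewrite mnm0E eqxx implybT.
rewrite monsS // mem_cat IHr; last lia.
rewrite (SmonS (Ordinal lt_in)) /=.
have [u0|u_gt0] := posnP (u (Ordinal lt_in)).
  rewrite andbT; case: (_ \in _) / mapP => // -[v _ uE].
  by move: u0; rewrite uE mnmDE xvarE eqxx.
rewrite andbF orbF.
have le_xu : (xvar i <= u)%MM.
  apply/mnm_lepP => j; rewrite xvarE; case: eqP => // ji.
  by have -> : j = Ordinal lt_in by apply: val_inj.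
have uE : u = (xvar i + (u - xvar i))%MM by rewrite addmC submK.
have -> : (u \in [seq (xvar i + v)%MM | v <- mons i d]) = ((u - xvar i)%MM \in mons i d).
  by rewrite {1}uE mem_map //; apply: addmI.
rewrite IHd {3 4}uE SmonD mdegD mdeg_varpow // add1n eqSS.
by rewrite Smon_varpow.
Qed.

Lemma pairwise_mons i d : pairwise (fun u v => lex_lt v u) (mons i d).
Proof.
have [r nE] : exists r, n <= r + i by exists n; apply: leq_addr.
elim: r i nE d => [|r IHr] i nE d; first by rewrite mons_n //; case: eqP.
case: (ltnP i n) => [lt_in|le_ni]; last by apply: IHr; lia.
elim: d => [|d IHd]; first by rewrite mons0.
rewrite monsS // pairwise_cat IHr ?andbT; last lia.
apply/andP; split; last first.
  by rewrite pairwise_map; apply: sub_pairwise IHd => u v /=; rewrite lex_lt_add.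
apply/allrelP => _ v /mapP[u u_in ->]; rewrite mem_mons => /andP[Sv _].
apply/existsP; exists (Ordinal lt_in).
rewrite mnmDE xvarE eqxx (SmonS (Ordinal lt_in)) in Sv *.
case/andP: Sv => Sv /eqP-> /=; apply/forallP => j; apply/implyP => lt_ji.
rewrite mnmDE xvarE (ltn_eqF lt_ji) add0n.
move: u_in; rewrite mem_mons => /andP[Su _].
by rewrite (eqP (implyP (forallP Su j) lt_ji)) (implyP (forallP Sv j) lt_ji).
Qed.

Lemma lex_lt_asym u v : mdeg u = mdeg v -> lex_lt u v -> ~~ lex_lt v u.
Proof. by move=> uv; rewrite !lex_ltE // -leNgt => /ltW. Qed.

Lemma lex_lt_irr u : lex_lt u u = false.
Proof. by rewrite lex_ltE ?ltxx. Qed.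

Lemma uniq_mons i d : uniq (mons i d).
Proof.
rewrite uniq_pairwise; apply: sub_pairwise (pairwise_mons i d) => u v.
by apply: contraTneq => ->; rewrite lex_lt_irr.
Qed.

Lemma lex_lt_index i d u v : u \in mons i d -> v \in mons i d ->
  lex_lt v u = (index u (mons i d) < index v (mons i d)).
Proof.
move=> u_in v_in.
have homo x y : x \in mons i d -> y \in mons i d ->
    index x (mons i d) < index y (mons i d) -> lex_lt y x.
  move=> x_in y_in lt_xy.
  have := pairwiseP 0%MM (pairwise_mons i d) (index x (mons i d)) (index y (mons i d)).
  by rewrite !inE !index_mem => /(_ x_in y_in lt_xy); rewrite !nth_index.
have degE x : x \in mons i d -> mdeg x = d by rewrite mem_mons => /andP[_ /eqP].
case: ltngtP => [/homo->//|/homo h|eq_i].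
  by apply/negbTE/lex_lt_asym; [rewrite !degE|exact: h].
have -> : u = v by rewrite -(nth_index 0%MM u_in) eq_i nth_index.
exact: lex_lt_irr.
Qed.

Definition nmons i d := size (mons i d).

Lemma nmons0 i : nmons i 0 = 1.
Proof. by rewrite /nmons mons0. Qed.

Lemma nmonsS i d : i < n -> nmons i d.+1 = nmons i d + nmons i.+1 d.+1.
Proof. by move=> lt_in; rewrite /nmons monsS // size_cat size_map. Qed.

Lemma nmons_le i d d' : i < n -> d <= d' -> nmons i d <= nmons i d'.
Proof.
move=> lt_in /subnK <-; elim: (d' - d) => //= k IHk.
by rewrite addSn nmonsS // (leq_trans IHk) // leq_addr.
Qed.

Lemma nmons_last i d : i < n <= i.+1 -> nmons i d = 1.
Proof.
case/andP=> lt_in le_ni; elim: d => [|d IHd]; first exact: nmons0.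
by rewrite nmonsS // IHd /nmons mons_n.
Qed.

Lemma nmons_gt i d : i.+1 < n -> d < nmons i d.
Proof.
move=> lt_in; elim: d => [|d IHd]; first by rewrite nmons0.
rewrite nmonsS ?(ltnW lt_in) //.
by have := nmons_le lt_in (leq0n d.+1); rewrite nmons0; lia.
Qed.

Lemma maxvar_le u k :
  (maxvar u <= k) = [forall j : 'I_n, (0 < u j) ==> (j <= k)].
Proof.
by apply/bigmax_leqP/forallP => h j; [apply/implyP/h | apply/implyP/h].
Qed.

Lemma maxvarD u v : maxvar (u + v)%MM = maxn (maxvar u) (maxvar v).
Proof.
have le_iff k : (maxvar (u + v)%MM <= k) = (maxvar u <= k) && (maxvar v <= k).
  rewrite !maxvar_le; apply/forallP/andP => [h|[/forallP hu /forallP hv] j].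
    by split; apply/forallP=> j; apply/implyP=> gt0; apply: (implyP (h j));
      rewrite mnmDE; lia.
  apply/implyP; rewrite mnmDE addn_gt0 => /orP[].
    exact/implyP.
  exact/implyP.
apply/eqP; rewrite eqn_leq le_iff leq_maxl leq_maxr /=.
by rewrite geq_max -le_iff.
Qed.

(** * Counting monomials in the variables up to [x_l] *)

Section Good.

Variable l : nat.

(** For a piece of [U], [maxvar (delta i)] is [i], so this is the bound on the largest variable of
    [delta i + u]. *)
Definition good i u := maxn i (maxvar u) <= l.

Lemma good_xvar i u : i < n -> good i (xvar i + u)%MM = good i u.
Proof.
move=> lt_in; rewrite /good maxvarD maxnA; congr (maxn _ _ <= _).
apply/maxn_idPl; rewrite maxvar_le; apply/forallP => j; apply/implyP.
by rewrite xvarE; case: eqP => // ->.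
Qed.

(** The degree is positive, so a variable after [x_i] occurs in [u], and the bounds [i] and [i.+1]
    make no difference. *)
Lemma good_succ i d u : u \in mons i.+1 d.+1 -> good i u = good i.+1 u.
Proof.
rewrite mem_mons => /andP[/forallP Su /eqP du].
rewrite /good; congr (_ <= _).
suff lt_i : i < maxvar u by rewrite !(maxn_idPr _) // ltnW.
rewrite ltnNge maxvar_le; apply/negP => /forallP h.
suff u0 : u = 0%MM by rewrite u0 mdeg0 in du.
apply/mnmP => j; rewrite mnm0E; apply/eqP; case: posnP => // u_gt0.
case: (ltnP j i.+1) => [lt_j|le_j]; first by have := implyP (Su j) lt_j; lia.
by have := implyP (h j) u_gt0; lia.
Qed.

Definition word i d := [seq good i u | u <- mons i d].

Lemma size_word i d : size (word i d) = nmons i d.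
Proof. by rewrite size_map. Qed.

Lemma wordS i d : i < n -> word i d.+1 = word i d ++ word i.+1 d.+1.
Proof.
move=> lt_in; rewrite /word monsS // map_cat -map_comp; congr (_ ++ _).
  by apply: eq_map => u /=; rewrite good_xvar.
by apply/eq_in_map => u; apply: good_succ.
Qed.

(** Multiplication by [x_i] preserves the word, and the monomials without [x_i] come after it, so
    each word is a prefix of those in larger degrees. *)
Lemma take_word i d d' z : i < n -> d <= d' -> z <= nmons i d ->
  take z (word i d') = take z (word i d).
Proof.
move=> lt_in /subnK <-; elim: (d' - d) => //= k IHk le_z.
rewrite addSn wordS // takel_cat ?IHk // size_word.
by apply: leq_trans le_z (nmons_le lt_in (leq_addl _ _)).
Qed.

(** Degree [z] serves as one with at least [z] monomials. With a single variable left, the word has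
    one letter and the count is cut off there. *)
Definition top_good i z := count id (take z (word i z)).

Lemma count_take_word i d z : i < n -> z <= nmons i d ->
  count id (take z (word i d)) = top_good i z.
Proof.
move=> lt_in le_z; rewrite /top_good; case: (leqP z d) => [le_zd|/ltnW le_dz].
  case: (ltnP i.+1 n) => [lt_in'|le_ni].
    by rewrite (take_word lt_in le_zd) // ltnW // nmons_gt.
  have e k := @nmons_last i k ltac:(by rewrite lt_in).
  by rewrite (take_word lt_in le_zd) // e -(e d).
by rewrite (take_word lt_in le_dz).
Qed.

Lemma top_good0 i : top_good i 0 = 0.
Proof. by rewrite /top_good take0. Qed.

Lemma top_good_bad i z : l < i -> top_good i z = 0.
Proof.
move=> lt_li; apply/eqP; rewrite eqn0Ngt -has_count -all_predC.
by apply/allP => b /mem_take /mapP[u _ ->]; rewrite /= /good -ltnNge leq_max lt_li.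
Qed.

Lemma top_good_word i d : i < n -> top_good i (nmons i d) = count id (word i d).
Proof. by move=> lt_in; rewrite -(@count_take_word i d) // take_oversize ?size_word. Qed.

Lemma top_goodS i d x : i.+1 < n -> x <= nmons i.+1 d.+1 ->
  top_good i (nmons i d + x) = top_good i (nmons i d) + top_good i.+1 x.
Proof.
move=> lt_in le_x; have lt_in' := ltnW lt_in.
rewrite -(@count_take_word i d.+1) //; last by rewrite nmonsS // leq_add2l.
rewrite wordS // take_cat size_word ltnNge leq_addr /= addKn count_cat.
by rewrite (count_take_word lt_in le_x) top_good_word.
Qed.

Lemma top_good1 i : i < n -> top_good i 1 = (i <= l).
Proof.
move=> lt_in; rewrite -(@count_take_word i 0) ?nmons0 // /word mons0 /= addn0.
rewrite /good; congr ((_ <= _) : nat); apply/maxn_idPl.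
by rewrite maxvar_le; apply/forallP => j; rewrite mnm0E.
Qed.

Lemma top_good_le i x y : i < n -> x <= y -> top_good i x <= top_good i y.
Proof.
move=> lt_in le_xy.
have -> : top_good i x = count id (take (minn x (nmons i x)) (word i y)).
  rewrite take_min (take_word lt_in le_xy (leqnn _)).
  by rewrite [take (nmons i x) _]take_oversize ?size_word.
rewrite /top_good -[in X in _ <= X](cat_take_drop (minn x (nmons i x)) (take y _)).
by rewrite count_cat take_takel ?leq_addr // geq_min le_xy.
Qed.

Hypothesis lt_ln : l < n.

Lemma count_take k (w : seq bool) : count id (take k w) <= count id w.
Proof. by rewrite -[in X in _ <= X](cat_take_drop k w) count_cat leq_addr. Qed.

Lemma word_level d : exists m, word l d = true :: nseq m false.
Proof.
elim: d => [|d [m IHd]].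
  exists 0; rewrite /word mons0 /= /good; congr (_ :: _).
  by rewrite geq_max leqnn maxvar_le; apply/forallP => j; rewrite mnm0E.
exists (m + nmons l.+1 d.+1); rewrite wordS // IHd nseqD /=; congr (_ :: _ ++ _).
rewrite -(size_word l.+1); apply/all_pred1P/allP => _ /mapP[u _ ->].
by rewrite /= /good eqbF_neg -ltnNge leq_max ltnSn.
Qed.

Lemma top_good_level z : top_good l z = (0 < z).
Proof.
have [m mE] := word_level z; rewrite /top_good mE; case: z mE => //= z _.
apply/eqP; rewrite eqSS -leqn0; apply: leq_trans (count_take _ _) _.
by rewrite count_nseq.
Qed.

Lemma sum_nmons i d : i < n -> \sum_(k < d.+1) nmons i.+1 k = nmons i d.
Proof.
move=> lt_in; elim: d => [|d IHd]; first by rewrite big_ord1 !nmons0.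
by rewrite big_ord_recr IHd nmonsS.
Qed.

(** Descending induction from [i = l], where only the first letter counts. The step from [i.+1] to
    [i] is an instance of the block sums, a block being the monomials with a given power of
    [x_i]. *)
Lemma top_good_subadd_top i : i <= l ->
  (forall x y, top_good i (x + y) <= top_good i x + top_good i y) /\
  (forall d x y, x <= y -> y <= nmons i d ->
    top_good i (nmons i d) + top_good i (y - x)
      <= top_good i y + top_good i (nmons i d - x)).
Proof.
move=> le_il; have [k lE] : exists k, l = i + k by exists (l - i); lia.
elim: k i lE {le_il} => [|k IHk] i lE.
  rewrite addn0 in lE; rewrite -lE; split=> [x y|d x y le_xy le_y].
    by rewrite !top_good_level; case: x y => [|x] [].
  rewrite !top_good_level; lia.
have [sub top] := IHk i.+1 ltac:(lia).
have lt_in1 : i.+1 < n by lia.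
have lt_in := ltnW lt_in1.
have M_gt0 d : 0 < nmons i.+1 d by rewrite -(nmons0 i.+1) nmons_le.
have M_mono d d' : d <= d' -> nmons i.+1 d <= nmons i.+1 d' by apply: nmons_le.
have F_block d x : x <= nmons i.+1 d ->
    top_good i (\sum_(k < d) nmons i.+1 k + x) =
    top_good i (\sum_(k < d) nmons i.+1 k) + top_good i.+1 x.
  case: d => [|d] le_x; last by rewrite sum_nmons // top_goodS.
  rewrite big_ord0 top_good0 !add0n; rewrite nmons0 in le_x.
  case: x le_x => [|[|//]] _; first by rewrite !top_good0.
  by rewrite !top_good1 //; lia.
have F0 := top_good0 i; have f0 := top_good0 i.+1.
split=> [x y|d x y le_xy le_y].
  exact: (block_sum_sub M_gt0 M_mono f0 sub top F0 F_block).
rewrite -sum_nmons // in le_y *.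
exact: (block_sum_top M_gt0 M_mono f0 sub top F0 F_block).
Qed.

Lemma top_good_subadd i x y :
  top_good i (x + y) <= top_good i x + top_good i y.
Proof.
case: (leqP i l) => [le_il|lt_li]; last by rewrite !top_good_bad.
by case: (top_good_subadd_top le_il).
Qed.

Lemma top_good_top i d x y : x <= y -> y <= nmons i d ->
  top_good i (nmons i d) + top_good i (y - x)
    <= top_good i y + top_good i (nmons i d - x).
Proof.
case: (leqP i l) => [le_il|lt_li]; last by rewrite !top_good_bad.
by case: (top_good_subadd_top le_il) => _; apply.
Qed.

Lemma top_good_mono i x y : x <= y -> top_good i x <= top_good i y.
Proof.
case: (leqP i l) => [le_il|lt_li]; last by rewrite !top_good_bad.
by apply: top_good_le; lia.
Qed.

End Good.

End Monomials.

(** * The pieces of [U] *)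

Lemma filter_drop (T : Type) (P : pred T) (w : seq T) :
  pairwise (fun x y => P x ==> P y) w ->
  [seq x <- w | P x] = drop (size w - count P w) w.
Proof.
elim: w => //= x w IHw /andP[Px pw]; case: ifP => [PxT|_]; last first.
  by rewrite IHw // add0n subSn ?count_size.
have Pw : all P w by apply: sub_all Px => y; rewrite PxT.
have /eqP-> : count P w == size w by rewrite -all_count.
by rewrite add1n subnn (all_filterP Pw).
Qed.

Lemma card_fset_count (T : choiceType) (A : {fset T}) (P : pred T) (w : seq T) :
  uniq w -> (forall x, x \in A -> P x -> x \in w) ->
  #|` [fset x in A | P x]%fset| = count (fun x => (x \in A) && P x) w.
Proof.
move=> w_uniq Aw; rewrite -size_filter; apply: perm_size.
apply: uniq_perm; rewrite ?fset_uniq ?filter_uniq // => x.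
rewrite mem_filter !inE /= ; apply/idP/idP => [/andP[xA Px]|/andP[/andP[-> ->]]//].
by rewrite xA Px Aw.
Qed.

Lemma card_bmnm_count n D (P : pred 'X_{1..n}) (w : seq 'X_{1..n}) :
  uniq w -> (forall h, h \in w -> mdeg h < D) ->
  (forall h, mdeg h < D -> P h -> h \in w) ->
  #|[pred h : 'X_{1..n < D} | P h]| = count P w.
Proof.
move=> w_uniq w_lt Pw; rewrite -size_filter cardE.
rewrite -(size_map val); apply: perm_size; apply: uniq_perm.
- by rewrite map_inj_uniq ?enum_uniq //; apply: val_inj.
- exact: filter_uniq.
move=> h; rewrite mem_filter; apply/mapP/andP => [[g]|[Ph h_in]].
  rewrite mem_enum inE => Pg ->; split=> //; apply: Pw => //; exact: bmdeg.
by exists (BMultinom (w_lt h h_in)) => //; rewrite mem_enum inE.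
Qed.

Section Pieces.

Variables (n t : nat) (a : t.-tuple int).
Hypothesis ha : universal_lex_data n a.
Implicit Types (u v w h f g : 'X_{1..n}) (i j d e : nat).

Local Notation de := (delta n a).
Local Notation b := (bdeg n a).

Lemma t_le_n : t <= n. Proof. by case: ha => /andP[]. Qed.

Lemma exponent_ge0 i : i < t -> 1 < t -> (0 <= a`_i)%R.
Proof.
case: ha => _ [ha0|aE] lt_it lt1t.
  by have := ha0 (Ordinal lt_it); rewrite (tnth_nth 0%R).
by have := size_tuple a; rewrite aE /=; lia.
Qed.

Lemma exponentS i : i < t -> 1 < t -> `|(a`_i + 1)%R|%N = (`|(a`_i)%R|%N).+1.
Proof. by move=> lt_it lt1t; have := exponent_ge0 lt_it lt1t; lia. Qed.

Lemma delta_lt i (j : 'I_n) : j < i -> de i j = `|(a`_j)%R|%N.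
Proof. by move=> lt_ji; rewrite mnmE lt_ji. Qed.

Lemma delta_eq i (j : 'I_n) : j = i :> nat -> de i j = `|(a`_i + 1)%R|%N.
Proof. by move=> E; rewrite mnmE E ltnn eqxx. Qed.

Lemma delta_gt i (j : 'I_n) : i < j -> de i j = 0.
Proof. by move=> lt_ij; rewrite mnmE ltnNge (ltnW lt_ij) /= gtn_eqF. Qed.

Lemma bdeg_mono i : i.+1 < t -> b i <= b i.+1.
Proof.
move=> lt_it; have lt1t : 1 < t by lia.
have lt_in : i.+1 < n by apply: leq_trans lt_it t_le_n.
pose c := `|(a`_i.+1 + 1)%R|%N.
(* [delta i.+1] times [x_i] is [delta i] times a power of [x_(i+1)] with exponent [c >= 1]; the
   claim follows by comparing degrees. *)
have E : (de i.+1 + xvar n i)%MM = (de i + varpow n i.+1 c)%MM.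
  apply/mnmP=> j; rewrite !mnmDE xvarE [varpow _ _ _ _]mnmE.
  case: (ltngtP j i) => [lt_ji|lt_ij|ji].
  - by rewrite !delta_lt ?ifN; lia.
  - rewrite (delta_gt lt_ij) addn0 add0n; case: eqP => [ji|/eqP ne_ji].
      by rewrite delta_eq.
    by rewrite delta_gt // ltn_neqAle eq_sym ne_ji.
  - rewrite delta_lt ?ji // delta_eq // exponentS ?(ltnW lt_it) //.
    by rewrite ifN; lia.
have := congr1 mdeg E; rewrite !mdegD !mdeg_varpow ?(ltnW lt_in) //.
rewrite -/(b i) -/(b i.+1) /c exponentS //; lia.
Qed.

Lemma maxvar_delta i : i < t -> maxvar (de i) = i.
Proof.
move=> lt_it; have lt_in : i < n by apply: leq_trans lt_it t_le_n.
apply/eqP; rewrite eqn_leq maxvar_le; apply/andP; split.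
  apply/forallP=> j; apply/implyP; case: (leqP j i) => // lt_ij.
  by rewrite delta_gt.
(* For [i = 0] the default value of [maxvar] is already right, so [delta 0] may be 1. *)
case: (posnP i) => [->//|i_gt0].
have lt1t : 1 < t by lia.
apply: (@leq_bigmax_cond _ _ (fun j : 'I_n => val j) (Ordinal lt_in)).
by rewrite delta_eq // exponentS.
Qed.

Lemma UpieceP i h : reflect (exists2 u, Smon i u & h = (de i + u)%MM) (Upiece a i h).
Proof.
apply: (iffP andP) => [[le_h Su]|[u Su ->]].
  by exists (h - de i)%MM; rewrite // addmC submK.
by rewrite lem_addr ?lemc_refl //; split=> //; rewrite addmC addmK.
Qed.

Lemma Upiece_delta i u : Upiece a i (de i + u)%MM = Smon i u.
Proof.
apply/UpieceP/idP => [[v Sv /addmI->//]|Su]; by exists u.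
Qed.

Definition piece_mons i e :=
  if b i <= e then [seq (de i + u)%MM | u <- mons n i (e - b i)] else [::].

Lemma size_piece_mons i e : size (piece_mons i e) = piece_at (nmons n) b i e.
Proof. by rewrite /piece_mons /piece_at; case: ifP; rewrite ?size_map. Qed.

Lemma mem_piece_mons i e h : (h \in piece_mons i e) = Upiece a i h && (mdeg h == e).
Proof.
rewrite /piece_mons; case: leqP => [le_be|lt_eb]; last first.
  apply/esym/negbTE/negP => /andP[/UpieceP[u _ ->]].
  rewrite mdegD -/(b i); lia.
apply/mapP/andP => [[u u_in ->]|[/UpieceP[u Su ->] /eqP du]].
  move: u_in; rewrite mem_mons => /andP[Su /eqP du].
  by rewrite Upiece_delta Su mdegD du -/(b i) subnKC.
exists u => //; rewrite mem_mons Su -du mdegD -/(b i) addKn eqxx //.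
Qed.

Lemma uniq_piece_mons i e : uniq (piece_mons i e).
Proof.
rewrite /piece_mons; case: ifP => // _.
by rewrite map_inj_uniq ?uniq_mons //; apply: addmI.
Qed.

Lemma pairwise_piece_mons i e : pairwise (fun u v => lex_lt v u) (piece_mons i e).
Proof.
rewrite /piece_mons; case: ifP => // _; rewrite pairwise_map.
by apply: sub_pairwise (pairwise_mons n i _) => u v; rewrite /= lex_lt_add.
Qed.

Lemma index_piece_mons i u : Smon i u ->
  index (de i + u)%MM (piece_mons i (mdeg (de i + u)%MM)) =
  index u (mons n i (mdeg u)).
Proof.
move=> Su; rewrite /piece_mons mdegD leq_addr addKn index_map //.
exact: addmI.
Qed.

Lemma dlex_le_index i e g h : g \in piece_mons i e -> h \in piece_mons i e ->
  dlex_le h g = (index g (piece_mons i e) <= index h (piece_mons i e)).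
Proof.
move=> g_in h_in; move: (g_in) (h_in).
rewrite !mem_piece_mons => /andP[/UpieceP[u Su gE] /eqP dg].
move=> /andP[/UpieceP[v Sv hE] /eqP dh].
have dE : mdeg u = mdeg v.
  by move: dg dh; rewrite gE hE !mdegD => <- /addnI.
rewrite /dlex_le /dlex_gt dg dh ltnn eqxx /=.
move: (index_piece_mons Su) (index_piece_mons Sv); rewrite -gE -hE dg dh => -> ->.
rewrite gE hE lex_lt_add (inj_eq (@addmI _ (de i))) dE.
rewrite (@lex_lt_index n i (mdeg v)) ?mem_mons ?Su ?Sv ?dE ?eqxx //.
have uin : u \in mons n i (mdeg v) by rewrite mem_mons Su dE eqxx.
have vin : v \in mons n i (mdeg v) by rewrite mem_mons Sv eqxx.
rewrite [in RHS]leq_eqVlt; congr (_ || _); apply/eqP/eqP => [->//|E].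
by rewrite -(nth_index 0%MM vin) -E nth_index.
Qed.

Lemma Uge_S i h : i < t -> Uge a i h = Upiece a i h || Uge a i.+1 h.
Proof.
move=> lt_it; apply/existsP/orP => [[k /andP[]]|[Uh|/existsP[k /andP[lt_ik Uh]]]].
- rewrite leq_eqVlt => /orP[/eqP->|lt_ik] Uh; first by left.
  by right; apply/existsP; exists k; rewrite lt_ik.
- by exists (Ordinal lt_it); rewrite leqnn.
- by exists k; rewrite ltnW.
Qed.

Lemma Uge_t h : Uge a t h = false.
Proof. by apply/negbTE/existsP => -[k]; rewrite leqNgt ltn_ord. Qed.

Lemma Upiece_coord i (j : 'I_n) h : Upiece a i h -> j < i -> h j = `|(a`_j)%R|%N.
Proof.
move=> /UpieceP[u Su ->] lt_ji; rewrite mnmDE delta_lt //.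
by rewrite (eqP (implyP (forallP Su j) lt_ji)) addn0.
Qed.

Lemma Upiece_coord_eq i (j : 'I_n) h : Upiece a i h -> j = i :> nat ->
  `|(a`_i + 1)%R|%N <= h j.
Proof. by move=> /UpieceP[u _ ->] ji; rewrite mnmDE delta_eq // leq_addr. Qed.

(** The exponent of [x_i] is at least [a_i + 1] in [U^(i)] and equals [a_i] in all later pieces,
    while the earlier exponents agree. *)
Lemma Uge_lex i g h : i < t -> Upiece a i g -> Uge a i.+1 h -> lex_lt h g.
Proof.
move=> lt_it Ug /existsP[k /andP[lt_ik Uh]].
have lt_in : i < n by apply: leq_trans lt_it t_le_n.
have lt1t : 1 < t by have := ltn_ord k; lia.
apply/existsP; exists (Ordinal lt_in).
rewrite (Upiece_coord (j := Ordinal lt_in) Uh) //=.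
have := Upiece_coord_eq (j := Ordinal lt_in) Ug erefl.
rewrite exponentS // => ->; apply/forallP => j; apply/implyP => lt_ji.
by rewrite (Upiece_coord Uh) ?(Upiece_coord Ug) // (ltn_trans lt_ji).
Qed.

Lemma Upiece_Uge i h : i < t -> Upiece a i h -> Uge a i.+1 h = false.
Proof.
move=> lt_it Uh; apply/negbTE/negP => /(Uge_lex lt_it Uh).
by rewrite lex_lt_irr.
Qed.

Fixpoint mons_below i D :=
  if D is D'.+1 then mons_below i D' ++ piece_mons i D' else [::].

Lemma mem_mons_below i D h :
  (h \in mons_below i D) = Upiece a i h && (mdeg h < D).
Proof.
elim: D => [|D IHD] /=; first by rewrite andbF.
by rewrite mem_cat IHD mem_piece_mons -andb_orr ltnS [in RHS]leq_eqVlt orbC.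
Qed.

Lemma uniq_mons_below i D : uniq (mons_below i D).
Proof.
elim: D => //= D IHD; rewrite cat_uniq IHD uniq_piece_mons andbT /=.
apply/hasPn => h; rewrite mem_piece_mons mem_mons_below => /andP[_ /eqP->].
by rewrite ltnn andbF.
Qed.

Lemma size_mons_below i D :
  size (mons_below i D) = piece_below (nmons n) b i D.
Proof.
elim: D => [|D IHD] /=; first by rewrite /piece_below /below sub0n big_ord0.
by rewrite size_cat IHD size_piece_mons piece_belowS.
Qed.

Fixpoint ge_mons r i D :=
  if r is r'.+1 then mons_below i D ++ ge_mons r' i.+1 D else [::].

Lemma mem_ge_mons r i D h : r + i = t ->
  (h \in ge_mons r i D) = Uge a i h && (mdeg h < D).
Proof.
elim: r i => [|r IHr] i ri /=; first by have -> : i = t by []; rewrite Uge_t.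
rewrite mem_cat mem_mons_below IHr; last lia.
by rewrite [in RHS]Uge_S -?andb_orl //; lia.
Qed.

Lemma uniq_ge_mons r i D : r + i = t -> uniq (ge_mons r i D).
Proof.
elim: r i => //= r IHr i ri; rewrite cat_uniq uniq_mons_below IHr ?andbT; last lia.
apply/hasPn => h; rewrite mem_ge_mons ?mem_mons_below; last lia.
case/andP=> Uh _; apply/negP => /andP[Uh' _].
by rewrite (Upiece_Uge _ Uh') in Uh; lia.
Qed.

Lemma size_ge_mons r i D : size (ge_mons r i D) = ge_below (nmons n) b r i D.
Proof. by elim: r i => //= r IHr i; rewrite size_cat IHr size_mons_below. Qed.

(** The last summand includes the degree of [g] itself, because by [Uge_lex] all of [U^(>i)] in that
    degree lies below [g]. *)
Lemma count_dlex_leE r i g : r + i.+1 = t -> Upiece a i g ->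
  count_dlex_le a i g =
  piece_below (nmons n) b i (mdeg g) +
  (piece_at (nmons n) b i (mdeg g) - index g (piece_mons i (mdeg g))) +
  ge_below (nmons n) b r i.+1 (mdeg g).+1.
Proof.
move=> ri Ug; set e := mdeg g; have lt_it : i < t by lia.
have ri1 : r.+1 + i = t by lia.
rewrite /count_dlex_le (@card_bmnm_count n e.+1
   (fun h => Uge a i h && dlex_le h g) (ge_mons r.+1 i e.+1)); first last.
- by move=> h lt_h /andP[Uh _]; rewrite mem_ge_mons // Uh.
- by move=> h; rewrite mem_ge_mons // => /andP[].
- exact: uniq_ge_mons.
rewrite /= !count_cat; congr (_ + _ + _).
- rewrite -size_mons_below; apply/eqP; rewrite -all_count; apply/allP => h.
  rewrite mem_mons_below => /andP[Uh lt_h].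
  by rewrite Uge_S // Uh /= /dlex_le /dlex_gt lt_h orbT.
- have g_in : g \in piece_mons i e by rewrite mem_piece_mons Ug eqxx.
  set z := index _ _; rewrite -size_piece_mons -size_drop.
  have -> : count (fun h => Uge a i h && dlex_le h g) (piece_mons i e) =
            count (fun h => z <= index h (piece_mons i e)) (piece_mons i e).
    apply: eq_in_count => h h_in; rewrite (dlex_le_index g_in h_in).
    by move: h_in; rewrite mem_piece_mons Uge_S // => /andP[-> _].
  rewrite -[in X in count _ X](cat_take_drop z (piece_mons i e)) count_cat.
  have zs : z <= size (piece_mons i e) by apply: index_size.
  have /eqP -> : count (fun h => z <= index h (piece_mons i e))
      (take z (piece_mons i e)) == 0.
    rewrite -leqn0 leqNgt -has_count; apply/hasPn => h h_in.
    by rewrite -ltnNge; apply: index_ltn.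
  rewrite add0n; apply/eqP; rewrite -all_count; apply/allP => h h_in.
  rewrite leqNgt; apply/negP => lt_h.
  have := uniq_piece_mons i e; rewrite -{1}(cat_take_drop z (piece_mons i e)) cat_uniq.
  case/and3P=> _ /hasPn/(_ h h_in); rewrite /= in_take ?lt_h //.
  by rewrite (mem_drop h_in).
- rewrite -size_ge_mons; apply/eqP; rewrite -all_count; apply/allP => h.
  rewrite mem_ge_mons // => /andP[Uh]; rewrite ltnS => le_h.
  rewrite Uge_S // Uh orbT /= /dlex_le /dlex_gt.
  move: le_h; rewrite leq_eqVlt => /orP[/eqP he|->]; last by rewrite orbT.
  by rewrite -/e he eqxx (Uge_lex lt_it Ug Uh) !orbT.
Qed.

(* [rho^k (delta i + u) = delta (i + k) + tail (i + k) u]. *)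
Definition tail k u : 'X_{1..n} := [multinom (if k <= j then u j else 0)%N | j < n].

Lemma tailE k u (j : 'I_n) : tail k u j = if k <= j then u j else 0.
Proof. by rewrite mnmE. Qed.

Lemma tail_id k u : Smon k u -> tail k u = u.
Proof.
move=> Su; apply/mnmP=> j; rewrite tailE; case: leqP => // lt_jk.
by rewrite (eqP (implyP (forallP Su j) lt_jk)).
Qed.

Lemma Smon_tail k u : Smon k (tail k u).
Proof.
by apply/forallP=> j; apply/implyP=> lt_jk; rewrite tailE leqNgt lt_jk.
Qed.

Lemma tail_tail k m u : m <= k -> tail k (tail m u) = tail k u.
Proof.
move=> le_mk; apply/mnmP=> j; rewrite !tailE; case: leqP => // le_kj.
by rewrite (leq_trans le_mk).
Qed.

Lemma tail0 k : tail k 0%MM = 0%MM.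
Proof. by apply/mnmP=> j; rewrite tailE mnm0E if_same. Qed.

Lemma moving_iterE i k u : Smon i u ->
  moving_iter a i k (de i + u)%MM = (de (i + k) + tail (i + k) u)%MM.
Proof.
move=> Su; elim: k => [|k IHk] /=; first by rewrite addn0 tail_id.
rewrite IHk /moving addnS; congr (_ + _)%MM; apply/mnmP=> j.
rewrite mnmE tailE; case: ltnP => // lt_j.
by rewrite addmC addmK tailE (ltnW lt_j).
Qed.

Lemma split_tail i (lt_in : i < n) u : Smon i u ->
  u = (varpow n i (u (Ordinal lt_in)) + tail i.+1 u)%MM.
Proof.
move=> Su; apply/mnmP=> j; rewrite mnmDE tailE mnmE.
case: (ltngtP j i) => [lt_ji|lt_ij|ji]; rewrite ?addn0 ?add0n //.
  by rewrite (eqP (implyP (forallP Su j) lt_ji)).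
by congr (u _); apply: val_inj.
Qed.

(** Above [x_i^c w] come the monomials with a larger power of [x_i], which correspond to those of
    degree [d] in [x_i, ...], and then those with the same power and a larger cofactor. *)
Lemma index_mons i c w : i < n -> Smon i.+1 w ->
  index (varpow n i c + w)%MM (mons n i (c + mdeg w)) =
  if mdeg w is d.+1 then nmons n i d + index w (mons n i.+1 (mdeg w)) else 0.
Proof.
move=> lt_in Sw; elim: c => [|c IHc].
  have -> : (varpow n i 0 + w)%MM = w.
    by apply/mnmP=> j; rewrite mnmDE mnmE if_same.
  rewrite add0n; case dw: (mdeg w) => [|d].
    by move/eqP: dw; rewrite mdeg_eq0 mons0 => /eqP->; rewrite /= eqxx.
  rewrite monsS // index_cat ifN ?size_map //.
  apply/mapP => -[v _ wE]; have := forallP Sw (Ordinal lt_in).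
  by rewrite /= ltnSn wE mnmDE xvarE eqxx.
have -> : (varpow n i c.+1 + w)%MM = (xvar n i + (varpow n i c + w))%MM.
  rewrite addmA; congr (_ + _)%MM; apply/mnmP=> j; rewrite mnmDE !mnmE.
  by case: eqP.
rewrite addSn monsS // index_cat mem_map; last exact: addmI.
rewrite mem_mons SmonD Smon_varpow // mdegD mdeg_varpow // eqxx andbT.
have -> : Smon i w.
  by move: Sw; rewrite (SmonS (Ordinal lt_in)) => /andP[].
by rewrite index_map //; apply: addmI.
Qed.

Lemma index_tail i u : i < n -> Smon i u ->
  index u (mons n i (mdeg u)) =
  if mdeg (tail i.+1 u) is d.+1
  then nmons n i d + index (tail i.+1 u) (mons n i.+1 (mdeg (tail i.+1 u)))
  else 0.
Proof.
move=> lt_in Su; have uE := split_tail lt_in Su.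
have dE : mdeg u = u (Ordinal lt_in) + mdeg (tail i.+1 u).
  by rewrite -[in RHS](mdeg_varpow (u (Ordinal lt_in)) lt_in) -mdegD -uE.
by rewrite dE -(index_mons (u (Ordinal lt_in)) lt_in (Smon_tail i.+1 u)) -uE.
Qed.

Lemma index_mons0 i w : i < n -> Smon i w ->
  (index w (mons n i (mdeg w)) == 0) = (w == varpow n i (mdeg w)).
Proof.
move=> lt_in Sw.
have i0 : index (varpow n i (mdeg w)) (mons n i (mdeg w)) = 0.
  have S0 : Smon i.+1 (0%MM : 'X_{1..n}) by apply/forallP=> j; rewrite mnm0E eqxx implybT.
  by have := index_mons (mdeg w) lt_in S0; rewrite mdeg0 addn0 addm0.
have w_in : w \in mons n i (mdeg w) by rewrite mem_mons Sw eqxx.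
have v_in : varpow n i (mdeg w) \in mons n i (mdeg w).
  by rewrite mem_mons Smon_varpow // mdeg_varpow ?eqxx.
apply/eqP/eqP => [w0|->]; last by rewrite mdeg_varpow // i0.
by apply: (index_inj 0%MM w_in v_in); rewrite /= w0 i0.
Qed.

Lemma index_lt i w : Smon i w -> index w (mons n i (mdeg w)) < nmons n i (mdeg w).
Proof. by move=> Sw; rewrite /nmons index_mem mem_mons Sw eqxx. Qed.

(** Intermediate between [admissible] and [admissible_gap]: conditions on tails, as in the former,
    in the recursive shape of the latter. *)
Fixpoint tail_admissible r i e u : Prop :=
  if r is r'.+1 then tail i.+1 u = 0%MM \/
    [/\ mdeg (tail i.+1 u) + b i.+1 <= e.+1,
        r' = 0 -> mdeg (tail i.+1 u) + b i.+1 <= e \/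
                  tail i.+1 u = varpow n i.+1 (mdeg (tail i.+1 u))
      & tail_admissible r' i.+1 e u]
  else True.

Lemma eq_tail_admissible r i e u v :
  tail i.+1 u = tail i.+1 v ->
  tail_admissible r i e u -> tail_admissible r i e v.
Proof.
elim: r i => //= r IHr i uv; rewrite uv => -[|[]]; first by left.
right; split=> //; apply: IHr => //.
by rewrite -(tail_tail u (leqnSn i.+1)) uv tail_tail.
Qed.

(** By [index_tail] the index of [u] is [nmons n i d] plus the index of its tail; this decomposition
    is unique because the second part is less than [nmons n i.+1 d.+1]. *)
Lemma tail_admissibleP r i e u : r + i.+1 = t -> Smon i u ->
  admissible_gap (nmons n) b r i e (index u (mons n i (mdeg u))) <->
  tail_admissible r i e u.
Proof.
elim: r i u => [|r IHr] i u ri Su //.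
have le_tn := t_le_n.
have lt_in : i < n by lia.
have lt_in1 : i.+1 < n by lia.
have lt_it : i.+1 < t by lia.
have Sw := Smon_tail i.+1 u.
have {}IHr := IHr i.+1 (tail i.+1 u) ltac:(lia) Sw.
have N_gt0 d : 0 < nmons n i d by rewrite -(nmons0 n i) nmons_le.
rewrite (index_tail lt_in Su) /=; set w := tail i.+1 u in IHr Sw *.
have tadm : tail_admissible r i.+1 e w <-> tail_admissible r i.+1 e u.
  by split; apply: eq_tail_admissible; rewrite /w tail_tail.
case dw: (mdeg w) => [|d].
  by move/eqP: dw; rewrite mdeg_eq0 => /eqP->; split; left.
rewrite dw in IHr.
have lt_idx : index w (mons n i.+1 d.+1) < nmons n i.+1 d.+1.
  by rewrite -dw index_lt.
have eq0 : index w (mons n i.+1 d.+1) = 0 <-> w = varpow n i.+1 (mdeg w).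
  have := index_mons0 lt_in1 Sw; rewrite dw => eq0.
  by split=> /eqP; [rewrite eq0|rewrite -eq0] => /eqP.
split=> [[|[d1 [z' [zE lt_z' le_d r0P adm']]]]|[w0|[le_d r0P adm']]].
- by have := N_gt0 d; lia.
- have NS k := @nmonsS n i k lt_in.
  have d1E : d1 = d.
    case: (ltngtP d1 d) => // h.
      have := nmons_le lt_in h; rewrite NS; lia.
    have := nmons_le lt_in h; rewrite NS; lia.
  subst d1; have {zE} z'E : z' = index w (mons n i.+1 d.+1) by lia.
  right; split=> //.
    by move=> r0; case: (r0P r0) => [|z0]; [left|right; rewrite -?dw; apply/eq0; lia].
  by apply/tadm/IHr; rewrite -z'E.
- by rewrite w0 mdeg0 in dw.
- right; exists d, (index w (mons n i.+1 d.+1)); split=> //.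
    by move=> r0; case: (r0P r0) => [|wE]; [left|right; apply/eq0; rewrite dw].
  by apply/IHr/tadm.
Qed.

Lemma admissibleP r i u : r + i.+1 = t -> Smon i u ->
  admissible a i (de i + u)%MM <->
  tail_admissible r i (mdeg (de i + u)%MM) u.
Proof.
move=> ri Su; rewrite /admissible Upiece_delta Su /=.
set e := mdeg (de i + u)%MM.
have le_tn := t_le_n.
case: r ri => [|r] ri; first by have -> : i.+1 == t by apply/eqP.
have -> : (i.+1 == t) = false by apply/eqP; lia.
rewrite /= moving_iterE //; have -> : i + (t.-1 - i) = t.-1 by lia.
pose ok k := (mdeg (tail k u) + b k <= e.+1) || (tail k u == 0%MM).
set last := (X in _ && X).
have -> : [forall j : 'I_t, (0 < j) && (i + j < t.-1) ==>
     ((mdeg (moving_iter a i j (de i + u)) <= e.+1)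
      || (moving_iter a i j (de i + u) == de (i + j)))] =
   [forall j : 'I_t, (i < j) && (j < t.-1) ==> ok j].
  have okE k : ((mdeg (moving_iter a i k (de i + u)) <= e.+1)
      || (moving_iter a i k (de i + u) == de (i + k))) = ok (i + k).
    rewrite moving_iterE // mdegD addnC -/(b _); congr (_ || _).
    by rewrite -{2}[de (i + k)]addm0 (inj_eq (@addmI _ _)).
  apply/forallP/forallP => h j; apply/implyP => /andP[gt lt].
    have lt_jt : j - i < t by have := ltn_ord j; lia.
    have := implyP (h (Ordinal lt_jt)); rewrite /= okE.
    have -> : i + (j - i) = j by lia.
    by apply; lia.
  have lt_jt : i + j < t by lia.
  rewrite okE; have := implyP (h (Ordinal lt_jt)); apply; rewrite /=; lia.
(* When the last image under [rho] has degree [e.+1], only equality remains in (b), since a power of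
   the first variable is lex-largest. *)
have lastE : last = (tail t.-1 u == 0%MM) ||
    (mdeg (tail t.-1 u) + b t.-1 <= e.+1) &&
    ((mdeg (tail t.-1 u) + b t.-1 <= e) ||
     (tail t.-1 u == varpow n t.-1 (mdeg (tail t.-1 u)))).
  have lt_n : t.-1 < n by lia.
  have Sw := Smon_tail t.-1 u; rewrite /last; set w := tail t.-1 u in Sw *.
  rewrite -{2}[de t.-1]addm0 (inj_eq (@addmI _ _)); congr (_ || _).
  have bE : b t.-1 = mdeg (de t.-1) by [].
  apply/andP/andP => -[le_b].
    rewrite /opdlex_ge /opdlex_gt !mdegD (inj_eq (@addmI _ _)) lex_lt_add.
    rewrite mdeg_varpow // -bE.
    case/or3P=> [/eqP wE|lt_w|/andP[/eqP dw]].
    - have dw : mdeg w = e.+1 - b t.-1 by rewrite wE mdeg_varpow.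
      by split; [lia|rewrite dw -wE eqxx orbT].
    - by split; [lia|apply/orP; left; lia].
    - have dw' : mdeg w = e.+1 - b t.-1 by lia.
      rewrite (@lex_lt_index n t.-1 (mdeg w)); first last.
      + by rewrite mem_mons Smon_varpow // mdeg_varpow // dw' eqxx.
      + by rewrite mem_mons Sw eqxx.
      have : index (varpow n t.-1 (mdeg w)) (mons n t.-1 (mdeg w)) = 0.
        apply/eqP; have := @index_mons0 t.-1 (varpow n t.-1 (mdeg w)) lt_n.
        by rewrite mdeg_varpow // eqxx; apply; apply: Smon_varpow.
      by rewrite dw' => ->.
  move=> h; split; first by lia.
  rewrite /opdlex_ge /opdlex_gt !mdegD (inj_eq (@addmI _ _)) lex_lt_add.
  rewrite mdeg_varpow // -bE.
  case: (leqP (mdeg w + b t.-1) e) h => [le_w _|lt_w /= /eqP wE].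
    by apply/orP; right; apply/orP; left; lia.
  have dw : e.+1 - b t.-1 = mdeg w by lia.
  by rewrite dw -wE eqxx.
rewrite lastE {last lastE}; set last := (X in _ && X).
have okP : [forall j : 'I_t, (i < j < t.-1) ==> ok j] <->
    (forall k, i < k < t.-1 -> ok k).
  split=> [/forallP h k /andP[gt lt]|h]; last first.
    by apply/forallP=> j; apply/implyP/h.
  have lt_kt : k < t by lia.
  by apply: (implyP (h (Ordinal lt_kt))); rewrite /= gt lt.
suff H : (forall k, i < k < t.-1 -> ok k) /\ last <-> tail_admissible r.+1 i e u.
  by split=> [/andP[/okP h1 h2]|/H[h1 h2]]; [apply/H|apply/andP; split=> //; apply/okP].
clear okP; clearbody e; elim: r i ri {Su} => [|r IHr] i ri.
  have tE : t.-1 = i.+1 by lia.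
  rewrite /last tE /=.
  split=> [[_ /orP[/eqP->|/andP[le_w /orP[le_w'|/eqP wE]]]]|[w0|[le_w wP _]]].
  - by left.
  - by right; split=> // _; left.
  - by right; split=> // _; right.
  - by split=> [k|]; [lia|rewrite w0 eqxx].
  - split=> [k|]; first by lia.
    rewrite le_w /=; case: (wP erefl) => [->|<-]; last by rewrite eqxx !orbT.
    by rewrite orbT.
have {}IHr := IHr i.+1 ltac:(lia).
have tail_le k m : tail k u = 0%MM -> k <= m -> tail m u = 0%MM.
  by move=> w0 le_km; rewrite -(tail_tail u le_km) w0 tail0.
rewrite -[tail_admissible r.+2 i e u]/(tail i.+1 u = 0%MM \/
    [/\ mdeg (tail i.+1 u) + b i.+1 <= e.+1,
        r.+1 = 0 -> mdeg (tail i.+1 u) + b i.+1 <= e \/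
                  tail i.+1 u = varpow n i.+1 (mdeg (tail i.+1 u))
      & tail_admissible r.+1 i.+1 e u]).
split=> [[h1 h2]|[w0|[le_w _ /IHr[h1 h2]]]].
- have := h1 i.+1 ltac:(lia); rewrite /ok => /orP[le_w|/eqP]; last by left.
  by right; split=> //; apply/IHr; split=> // k ltk; apply: h1; lia.
- split=> [k /andP[gt _]|]; first by rewrite /ok (tail_le _ _ w0) ?eqxx ?orbT.
  by rewrite /last (tail_le _ _ w0) ?eqxx //; lia.
- split=> // k /andP[gt lt]; case: (ltngtP k i.+1) => [|gt1|->]; first by lia.
    by apply: h1; rewrite gt1.
  by rewrite /ok le_w.
Qed.

End Pieces.

(** * Ladder sets and extremal sets *)

Section Comparison.

Variables (n t : nat) (a : t.-tuple int) (l : nat).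
Hypothesis ha : universal_lex_data n a.
Hypothesis lt_ln : l < n.
Implicit Types (u v w h f g : 'X_{1..n}) (i j d e : nat).

Local Notation de := (delta n a).
Local Notation b := (bdeg n a).
Local Notation N := (nmons n).
Local Notation s := (top_good n l).
Local Notation low := (fun h : 'X_{1..n} => maxvar h <= l).

Lemma low_delta i u : i < t -> low (de i + u)%MM = good l i u.
Proof. by move=> lt_it; rewrite /= maxvarD (maxvar_delta ha). Qed.

Lemma count_low_drop i e z : i < t -> z <= piece_at N b i e ->
  count low (drop z (piece_mons n a i e)) + s i z = s i (piece_at N b i e).
Proof.
move=> lt_it; have lt_in : i < n by have := t_le_n ha; lia.
have mapE (w : seq 'X_{1..n}) : count low w = count id [seq low h | h <- w].
  by rewrite count_map.
rewrite mapE map_drop -size_piece_mons /piece_mons; case: ifP => _ /=; last first.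
  by rewrite leqn0 => /eqP->.
rewrite size_map -map_comp.
have -> : [seq low (de i + u)%MM | u <- mons n i (e - b i)] = word n l i (e - b i).
  by apply: eq_map => u; apply: low_delta.
move=> le_z; rewrite -(count_take_word l lt_in le_z) addnC -count_cat cat_take_drop.
by rewrite -(top_good_word l).
Qed.

Lemma count_low_below i D : i < t ->
  count low (mons_below n a i D) = value_below N s b i D.
Proof.
move=> lt_it; elim: D => [|D IHD] /=; first by rewrite /value_below big_ord0.
rewrite count_cat IHD value_belowS; last exact: top_good0.
by have := @count_low_drop i D 0 lt_it isT; rewrite drop0 top_good0 addn0 => ->.
Qed.

Lemma count_ge_mons (A : {fset 'X_{1..n}}) r i D (P : pred 'X_{1..n}) :
  r + i = t -> (forall h, h \in A -> mdeg h < D) ->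
  #|` [fset h in A | Uge a i h && P h]%fset| =
  count (fun h => (h \in A) && P h) (ge_mons n a r i D).
Proof.
move=> ri A_lt; rewrite (card_fset_count (w := ge_mons n a r i D)).
- by apply: eq_in_count => h; rewrite mem_ge_mons // => /andP[->].
- exact: uniq_ge_mons.
- by move=> h hA /andP[Uh _]; rewrite mem_ge_mons // Uh A_lt.
Qed.

(** * Ladder sets as configurations *)

Section Ladder.

Variables (K : fieldType) (M : {fset 'X_{1..n}}) (D : nat).
Hypothesis hM : ladder_set a K M.

Lemma mem_Npiece i u : (u \in Npiece a M i) = Smon i u && ((de i + u)%MM \in M).
Proof. by []. Qed.

Lemma ladder_rev_lex i u v : i < t -> Smon i u -> Smon i v ->
  mdeg u = mdeg v -> lex_lt v u -> (de i + u)%MM \in M -> (de i + v)%MM \in M.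
Proof.
case: hM => _ rl _ lt_it Su Sv uv lt_vu uM; case: (rl i lt_it) => /(_ u v) + _.
rewrite !mem_Npiece Su Sv uM /= => /(_ isT isT).
by rewrite uv lt_vu => /(_ erefl isT).
Qed.

Lemma ladder_divisor i u v : i < t -> Smon i u -> Smon i v ->
  (v <= u)%MM -> (de i + u)%MM \in M -> (de i + v)%MM \in M.
Proof.
case: hM => _ mc _ lt_it Su Sv le_vu uM; case: (mc i lt_it) => _ /(_ u v).
by rewrite !mem_Npiece Su Sv uM /= => /(_ isT le_vu).
Qed.

Lemma bdeg_le i j : i <= j -> j < t -> b i <= b j.
Proof.
move=> /subnK <-; elim: (j - i) => // k IHk lt_t.
rewrite addSn in lt_t *; apply: leq_trans (bdeg_mono ha lt_t).
by apply: IHk; lia.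
Qed.

Lemma ladder_full i k h g : h \in M -> Upiece a i h -> i < k < t ->
  Upiece a k g -> mdeg g <= mdeg h -> g \in M.
Proof.
move=> hM0 Uh /andP[lt_ik lt_kt] Ug le_gh; have le_tn := t_le_n ha.
have step i1 h1 g1 : i1.+1 < t -> h1 \in M -> Upiece a i1 h1 ->
    Upiece a i1.+1 g1 -> mdeg g1 <= mdeg h1 -> g1 \in M.
  move=> lt_t h1M Uh1 /UpieceP[u Su ->]; rewrite mdegD => le_u.
  (* Multiplying by a power of the last variable, which belongs to every [S^(k)], raises [g1] to the
     degree of [h1]. There the next piece is full, and the multicomplex property divides by that
     power again. *)
  pose c := mdeg h1 - (mdeg (de i1.+1) + mdeg u).
  have lt_n : n.-1 < n by lia.
  have Suc : Smon i1.+1 (u + varpow n n.-1 c)%MM.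
    by rewrite SmonD Su Smon_varpow //; lia.
  apply: (@ladder_divisor i1.+1 (u + varpow n n.-1 c)%MM) => //.
    by apply: lem_addr; apply: lemc_refl.
  have [_ _ full] := hM.
  have ex : exists2 h0, h0 \in piece a M i1 & mdeg h0 = mdeg h1.
    by exists h1; rewrite // !inE h1M.
  have := full i1 (mdeg h1) lt_t ex (de i1.+1 + (u + varpow n n.-1 c))%MM.
  rewrite !mdegD mdeg_varpow // Upiece_delta Suc !inE => E.
  by have /andP[] := E ltac:(rewrite /c; lia).
have [m mE] : exists m, k = i + m.+1 by exists (k - i.+1); lia.
elim: m i h k g mE hM0 Uh lt_ik lt_kt Ug le_gh
  => [|m IHm] i h k g kE hM0 Uh lt_ik lt_kt Ug le_gh.
  have kE1 : k = i.+1 by lia.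
  by rewrite kE1 in lt_kt Ug; apply: (step i h).
have lt_t : i.+1 < t by lia.
have le_b : b i.+1 <= mdeg h.
  apply: leq_trans le_gh; apply: leq_trans (bdeg_le (_ : i.+1 <= k) lt_kt) _; first lia.
  by case/UpieceP: Ug => u _ ->; rewrite mdegD leq_addr.
have lt_n : i.+1 < n by lia.
pose h2 := (de i.+1 + varpow n i.+1 (mdeg h - b i.+1))%MM.
have dh2 : mdeg h2 = mdeg h by rewrite mdegD mdeg_varpow // -/(b _) subnKC.
have Uh2 : Upiece a i.+1 h2 by rewrite Upiece_delta Smon_varpow.
apply: (IHm i.+1 h2 k g) => //; try lia.
by apply: (step i h) => //; rewrite dh2.
Qed.

Lemma ladder_filter i e : i < t ->
  [seq h <- piece_mons n a i e | h \in M] =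
  drop (piece_at N b i e - count (mem M) (piece_mons n a i e)) (piece_mons n a i e).
Proof.
move=> lt_it; rewrite -size_piece_mons; apply: filter_drop.
apply: (@sub_in_pairwise _ (mem (piece_mons n a i e)) (fun u v => lex_lt v u));
  [|exact: allss|exact: pairwise_piece_mons].
move=> g h; rewrite /= !mem_piece_mons.
move=> /andP[/UpieceP[u Su ->] /eqP du] /andP[/UpieceP[v Sv ->] /eqP dv].
rewrite lex_lt_add => lt_vu; apply/implyP; apply: ladder_rev_lex => //.
by apply: (@addnI (b i)); rewrite /bdeg -!mdegD du dv.
Qed.

Lemma ladder_value i e : i < t ->
  count (fun h => (h \in M) && low h) (piece_mons n a i e) +
    s i (piece_at N b i e - count (mem M) (piece_mons n a i e)) =
  s i (piece_at N b i e).
Proof.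
move=> lt_it; set z := _ - _.
rewrite -(@count_low_drop i e z lt_it (leq_subr _ _)) -ladder_filter // count_filter.
by congr (_ + _); apply: eq_count => h; rewrite /= andbC.
Qed.

Lemma count_mons_below (P : pred 'X_{1..n}) i d :
  count P (mons_below n a i d) = \sum_(e < d) count P (piece_mons n a i e).
Proof.
elim: d => [|d IHd]; first by rewrite big_ord0.
by rewrite /= count_cat IHd big_ord_recr.
Qed.

(** [collect_degrees] replaces each piece of [M] by a lower dlex segment of the same size and at
    least the same value. *)
Lemma ladder_config r i : r + i = t -> exists2 v,
  config N s b r i (count (mem M) (ge_mons n a r i D)) v &
  count (fun h => (h \in M) && low h) (ge_mons n a r i D) <= v.
Proof.
elim: r i => [|r IHr] i ri; first by exists 0.
have lt_it : i < t by lia.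
have lt_in : i < n by have := t_le_n ha; lia.
have [v' cfg' le_v'] := IHr i.+1 ltac:(lia).
have [e [k [le_k pE vE eP]]] := @collect_degrees t N s b
  (fun j d lt_jt => nmons_le (leq_trans lt_jt (t_le_n ha)) (leqnSn d))
  (top_good0 n l) (top_good_subadd lt_ln)
  (fun j d x y _ => @top_good_top n l lt_ln j d x y) i D
  (fun e => count (mem M) (piece_mons n a i e))
  (fun e => count (fun h => (h \in M) && low h) (piece_mons n a i e)) lt_it
  (fun e => leq_trans (count_size _ _) (eq_leq (size_piece_mons n a i e)))
  (fun e => ladder_value e lt_it).
set p' := count (mem M) (ge_mons n a r i.+1 D) in cfg'.
have le_s :=
  @top_good_mono n l lt_ln i _ (piece_at N b i e) (leq_subr k (piece_at N b i e)).
exists (value_below N s b i e +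
  (s i (piece_at N b i e) - s i (piece_at N b i e - k)) + v'); last first.
  rewrite /= count_cat count_mons_below; apply: leq_add => //.
  by set V := \sum_(_ < D) _ in vE *; lia.
exists e, k, p', v'; split=> //.
- by rewrite /= count_cat count_mons_below pE.
- by lia.
(* The merged segment reaches no higher degree than [M] does in [U^(i)]; [ladder_full], applied in a
   degree reached by [M], gives the size condition. *)
suff H : e = 0 /\ k = 0 \/ ge_below N b r i.+1 e.+1 <= p'.
  case: H => [[-> ->]|le_p'].
    split=> //; apply: leq_trans (leq0n _); rewrite -(size_ge_mons n a r i.+1 0).
    by elim: (r) (i.+1) => //= r' IH' i'; apply: IH'.
  by split=> [|_ //]; apply: leq_trans le_p'; apply: ge_below_le.
case: eP => [|[e' lt_e' [gt0 le_e']]]; [by left|right].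
apply: leq_trans (ge_below_le _ _ _ _ (_ : e.+1 <= e'.+1)) _ => //.
rewrite -size_ge_mons /p' -size_filter; apply: uniq_leq_size.
  by apply: (uniq_ge_mons ha); lia.
have [h h_in hM0] : exists2 h, h \in piece_mons n a i e' & h \in M.
  by apply/hasP; rewrite has_count.
move: h_in; rewrite mem_piece_mons => /andP[Uh /eqP dh].
move=> g; rewrite mem_filter !mem_ge_mons; try lia.
case/andP=> Ug lt_g; rewrite Ug (leq_trans lt_g lt_e') /= andbT.
case/existsP: Ug => k1 /andP[lt_ik Ug].
by apply: (ladder_full hM0 Uh _ Ug); rewrite ?lt_ik ?ltn_ord // dh.
Qed.

End Ladder.

(** * Extremal sets in terms of ranks *)

Section Extremal.

Variables (K : fieldType) (L : {fset 'X_{1..n}}) (D : nat).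
Hypothesis hL : extremal_set a K L.
Hypothesis L_lt : forall h, h \in L -> mdeg h < D.

Lemma admissible_index r i f : r + i.+1 = t -> Upiece a i f ->
  admissible a i f <->
  admissible_gap N b r i (mdeg f) (index f (piece_mons n a i (mdeg f))).
Proof.
move=> ri /UpieceP[u Su ->]; rewrite index_piece_mons //.
apply: iff_trans (admissibleP ha ri Su) _; apply: iff_sym.
exact: tail_admissibleP.
Qed.

Lemma card_piece_ge r i : r + i = t ->
  #|` piece_ge a L i| = count (mem L) (ge_mons n a r i D).
Proof.
move=> ri; rewrite -(eq_count (a1 := fun h => (h \in L) && true)); last first.
  by move=> h; rewrite /= andbT.
rewrite -count_ge_mons //; congr #|` _|; apply/fsetP => h.
by rewrite !inE /= andbT.
Qed.

Lemma candidate_fits r i f : r + i.+1 = t -> extremal_candidate a L i f ->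
  fits N b r i (count (mem L) (ge_mons n a r.+1 i D)) (mdeg f)
    (piece_at N b i (mdeg f) - index f (piece_mons n a i (mdeg f))).
Proof.
move=> ri [Uf adm_f le_f].
have f_in : f \in piece_mons n a i (mdeg f) by rewrite mem_piece_mons Uf eqxx.
have lt_f : index f (piece_mons n a i (mdeg f)) < piece_at N b i (mdeg f).
  by rewrite -size_piece_mons index_mem.
split; first by rewrite subn_gt0.
- exact: leq_subr.
- by rewrite subKn ?(ltnW lt_f) //; apply/(admissible_index ri Uf).
- by rewrite -(count_dlex_leE ha ri Uf) -card_piece_ge //; lia.
Qed.

Lemma fits_candidate r i e k : r + i.+1 = t ->
  fits N b r i (count (mem L) (ge_mons n a r.+1 i D)) e k ->
  exists f, [/\ extremal_candidate a L i f, mdeg f = e &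
    k = piece_at N b i e - index f (piece_mons n a i e)].
Proof.
move=> ri [k_gt0 le_k adm_k le_p].
pose f := nth 0%MM (piece_mons n a i e) (piece_at N b i e - k).
have lt_z : piece_at N b i e - k < size (piece_mons n a i e).
  by rewrite size_piece_mons; lia.
have f_in : f \in piece_mons n a i e by apply: mem_nth.
have idx : index f (piece_mons n a i e) = piece_at N b i e - k.
  by apply: index_uniq => //; apply: uniq_piece_mons.
move: (f_in); rewrite mem_piece_mons => /andP[Uf /eqP df].
exists f; rewrite idx subKn //; split=> //; split=> //.
  by apply/(admissible_index ri Uf); rewrite df idx.
by rewrite (count_dlex_leE ha ri Uf) df idx subKn // (@card_piece_ge r.+1) //; lia.
Qed.

Lemma count_below_dlex i f d (P : pred 'X_{1..n}) : Upiece a i f -> mdeg f < d ->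
  count (fun h => dlex_le h f && P h) (mons_below n a i d) =
  count P (mons_below n a i (mdeg f)) +
  count P (drop (index f (piece_mons n a i (mdeg f))) (piece_mons n a i (mdeg f))).
Proof.
move=> Uf; set e := mdeg f; elim: d => // d IHd.
have low_d d' : d' <= e -> count (fun h => dlex_le h f && P h) (mons_below n a i d') =
    count P (mons_below n a i d').
  move=> le_d; apply: eq_in_count => h; rewrite mem_mons_below => /andP[_ lt_h].
  by rewrite /dlex_le /dlex_gt (leq_trans lt_h le_d) orbT.
rewrite ltnS leq_eqVlt /= count_cat => /orP[/eqP<-|lt_d].
  rewrite low_d //; congr (_ + _); set z := index _ _.
  have f_in : f \in piece_mons n a i e by rewrite mem_piece_mons Uf eqxx.
  rewrite -[in LHS](cat_take_drop z (piece_mons n a i e)) count_cat.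
  have in_pm h : h \in take z (piece_mons n a i e) \/ h \in drop z (piece_mons n a i e) ->
      h \in piece_mons n a i e by case=> [/mem_take|/mem_drop].
  rewrite (@eq_in_count _ _ pred0 (take _ _)); last first.
    move=> h h_in; rewrite (dlex_le_index f_in) ?in_pm //; last by left.
    by rewrite leqNgt -/z (index_ltn h_in).
  rewrite count_pred0 add0n; apply: eq_in_count => h h_in.
  rewrite (dlex_le_index f_in) ?in_pm //; last by right.
  case: leqP => // lt_h; have := uniq_piece_mons n a i e.
  rewrite -{1}(cat_take_drop z (piece_mons n a i e)) cat_uniq.
  by case/and3P=> _ /hasPn/(_ h h_in); rewrite /= in_take ?lt_h // (mem_drop h_in).
rewrite IHd // -[RHS]addn0; congr (_ + _); apply/eqP; rewrite -leqn0 leqNgt -has_count.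
apply/hasPn => h; rewrite mem_piece_mons => /andP[_ /eqP dh].
rewrite negb_and /dlex_le /dlex_gt -/e dh (ltn_eqF lt_d) [d < e]ltnNge (ltnW lt_d) /=.
by rewrite orbF; apply/orP; left; apply: contraTneq lt_d => fE; rewrite -dh fE ltnn.
Qed.

(** Through [candidate_fits] and [fits_candidate], the dlex-largest candidate becomes the largest
    pair of degree and rank from below. *)
Lemma extremal_set_extremal r i : r + i = t ->
  extremal N s b r i (count (mem L) (ge_mons n a r i D))
    (count (fun h => (h \in L) && low h) (ge_mons n a r i D)).
Proof.
elim: r i => [|r IHr] i ri //; have lt_it : i < t by lia.
have ri1 : r + i.+1 = t by lia.
have {}IHr := IHr i.+1 ri1.
rewrite /= !count_cat.
case: hL => _ /(_ i lt_it) [[f [cand_f max_f pieceE]]|[no_f piece0]].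
  left; set e := mdeg f; have [Uf _ _] := cand_f.
  have f_in : f \in piece_mons n a i e by rewrite mem_piece_mons Uf eqxx.
  set z := index f (piece_mons n a i e).
  have lt_z : z < piece_at N b i e by rewrite -size_piece_mons index_mem.
  have inL h : h \in mons_below n a i D -> (h \in L) = dlex_le h f.
    rewrite mem_mons_below => /andP[Uh _].
    by have := pieceE h; rewrite !inE Uh /= andbT.
  have lt_eD : e < D.
    by apply: L_lt; have := pieceE f; rewrite !inE Uf /= andbT /dlex_le eqxx => ->.
  have countE (P : pred 'X_{1..n}) :
      count (fun h => (h \in L) && P h) (mons_below n a i D) =
      count P (mons_below n a i e) + count P (drop z (piece_mons n a i e)).
    rewrite -(count_below_dlex P Uf lt_eD); apply: eq_in_count => h h_in.
    by rewrite inL.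
  have sizeE : count (mem L) (mons_below n a i D) =
      piece_below N b i e + (piece_at N b i e - z).
    have := countE predT; rewrite !count_predT size_mons_below size_drop size_piece_mons.
    by move <-; apply: eq_count => h; rewrite /= andbT.
  exists e, (piece_at N b i e - z), (count (mem L) (ge_mons n a r i.+1 D)).
  exists (count (fun h => (h \in L) && low h) (ge_mons n a r i.+1 D)).
  split=> //.
  - by have := candidate_fits ri1 cand_f; rewrite /= count_cat.
  - move=> e1 k1; rewrite -count_cat => /(fits_candidate ri1) [g [cand_g dg ->]].
    have := max_f g cand_g; have [Ug _ _] := cand_g.
    case: (ltngtP e1 e) => [lt_e _|lt_e|e1E]; first by left.
      rewrite /dlex_le /dlex_gt dg -/e ltnNge (ltnW lt_e) [e == e1]ltn_eqF //= orbF.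
      by move/eqP=> gE; move: lt_e; rewrite /e -gE dg ltnn.
    have g_in : g \in piece_mons n a i e by rewrite mem_piece_mons Ug dg e1E eqxx.
    by rewrite (dlex_le_index f_in g_in) e1E => le_z; right; split=> //; lia.
  - by rewrite sizeE.
  - rewrite countE count_low_below // subKn ?(ltnW lt_z) //.
    by rewrite addnAC -(count_low_drop lt_it (ltnW lt_z)) addnA.
right; have L0 h : h \in mons_below n a i D -> (h \in L) = false.
  rewrite mem_mons_below => /andP[Uh _]; apply/negP => hL0.
  by have : h \in piece a L i; [rewrite !inE hL0 | rewrite piece0 inE].
have count0 (P : pred 'X_{1..n}) :
    count (fun h => (h \in L) && P h) (mons_below n a i D) = 0.
  by rewrite (@eq_in_count _ _ pred0) ?count_pred0 // => h /L0->.
split.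
  by move=> e k; rewrite -count_cat => /(fits_candidate ri1) [g [/no_f]].
rewrite count0 (@eq_in_count _ (mem L) pred0) ?count_pred0 //.
Qed.

End Extremal.

End Comparison.

Theorem theorem6p1 (K : fieldType) (n t : nat) (a : t.-tuple int)
    (ha : universal_lex_data n a) (M L : {fset 'X_{1..n}})
    (hM : ladder_set a K M) (hL : extremal_set a K L)
    (hcard : #|` L| = #|` M|) :
  succeq (mvec L) (mvec M).
Proof.
move=> l.
(* [D] exceeds all degrees that occur, so both sets are contained in the list
   [ge_mons n a t 0 D]. *)
pose D := (\max_(h <- M) mdeg h + \max_(h <- L) mdeg h).+1.
have M_lt h : h \in M -> mdeg h < D.
  move=> hM0; rewrite /D ltnS (leq_trans _ (leq_addr _ _)) //.
  exact: leq_bigmax_seq.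
have L_lt h : h \in L -> mdeg h < D.
  move=> hL0; rewrite /D ltnS (leq_trans _ (leq_addl _ _)) //.
  exact: leq_bigmax_seq.
have t0 : t + 0 = t by rewrite addn0.
have countE (A : {fset 'X_{1..n}}) (P : pred 'X_{1..n}) :
    (forall h, h \in A -> mdeg h < D) -> (forall h, h \in A -> Umon a K h) ->
    #|` [fset h in A | P h]%fset| = count (fun h => (h \in A) && P h) (ge_mons n a t 0 D).
  move=> A_lt A_U; rewrite -(count_ge_mons ha) //; congr #|` _|.
  apply/fsetP => h; rewrite !inE /=; case hA: (h \in A) => //=.
  by have /(UmonP K h ha)-> := A_U h hA.
have cardE (A : {fset 'X_{1..n}}) :
    (forall h, h \in A -> mdeg h < D) -> (forall h, h \in A -> Umon a K h) ->
    #|` A| = count (mem A) (ge_mons n a t 0 D).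
  move=> A_lt A_U; have := countE A predT A_lt A_U.
  have -> : [fset h in A | predT h]%fset = A by apply/fsetP => h; rewrite !inE andbT.
  by move->; apply: eq_count => h; rewrite /= andbT.
have [M_U _ _] := hM; have [L_U _] := hL.
rewrite /mvec !countE //.
have [v cfg le_v] := ladder_config ha (ltn_ord l) D hM t0.
apply: leq_trans le_v _.
have ext := extremal_set_extremal ha (ltn_ord l) hL L_lt t0.
rewrite -cardE // hcard cardE // in ext.
have le_tn := t_le_n ha.
apply: (@config_le_extremal t (nmons n) (top_good n l) (bdeg n a)) t0 cfg ext.
- by move=> j; apply: bdeg_mono.
- by move=> j _; apply: nmons0.
- by move=> j d lt_jt; apply: nmons_le => //; apply: leq_trans le_tn.
- by move=> j d lt_jt; apply: nmonsS; lia.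
- exact: top_good0.
- exact: top_good_mono.
- exact: top_good_subadd.
- by move=> j d x y _; apply: top_good_top.
- by move=> j d x lt_jt; apply: top_goodS; lia.
- by move=> j lt_jt; rewrite !top_good1; lia.
Qed.
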